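(* Let $S$ be a $(k+1)$-neighbourly polytopal sphere of dimension $2k+1$. Then $S\in\mathcal{W}_k(2k+1)$.
   Context: All simplicial complexes are finite and abstract, with the empty set as a face. A triangulated sphere is polytopal if it is isomorphic to the boundary complex of a simplicial convex polytope $P$, i.e. to the abstract complex of all vertex subsets $A$ of $P$ such that $\mathrm{conv}(A)$ is a proper face of $P$. A complex is $l$-neighbourly if any $l$ of its vertices form a face. For a finite set $\alpha$, $\overline{\alpha}$ is the complex of all subsets of $\alpha$ and $\partial\alpha$ the complex of all proper subsets. The join $X\ast Y$ (disjoint vertex sets) has as faces the disjoint unions of a face of $X$ and a face of $Y$. The standard sphere $S^d_{d+2}$ is $\partial\alpha$ with $\#\alpha=d+2$. Complexes are identified up to isomorphism. Bistellar moves: if $X$ is $d$-dimensional and $\alpha,\beta$ are disjoint nonempty sets with $\dim\alpha+\dim\beta=d$ (where $\dim\alpha=\#\alpha-1$) such that the set of faces of $X$ contained in $\alpha\sqcup\beta$ is exactly $\overline{\alpha}\ast\partial\beta$, then $Y=(X\setminus(\overline\alpha\ast\partial\beta))\cup(\partial\alpha\ast\overline\beta)$ is obtained from $X$ by the bistellar move $\alpha\mapsto\beta$, of index $\dim\beta$ (if $\beta$ is a single vertex, it is a new vertex). For $0\le k\le d+1$, a $d$-dimensional complex is $k$-stellated if it is obtained from $S^d_{d+2}$ by a finite sequence of bistellar moves, each of index $<k$ ($S^d_{d+2}$ is the only $0$-stellated one). The link of a vertex $x$ in $X$ is $\{\alpha\in X: x\notin\alpha,\ \alpha\sqcup\{x\}\in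 X\}$. For $0\le k\le d$, $\mathcal{W}_k(d)$ is the class of connected $d$-dimensional simplicial complexes all of whose vertex links are $k$-stellated $(d-1)$-spheres. *)

(* Defs.v *)
From mathcomp Require Import all_boot all_order all_algebra finmap.
From mathcomp Require Import classical_sets reals.

Set Implicit Arguments.
Unset Strict Implicit.
Unset Printing Implicit Defensive.

Import Order.TTheory GRing.Theory Num.Theory.
Local Open Scope fset_scope.
Local Open Scope ring_scope.

(** * Finite abstract simplicial complexes

    A complex with vertices taken in [K] is the finite set of its faces; its
    vertices are the elements of its faces, not all elements of [K]. *)

Section Complexes.
Context {K : choiceType}.
Implicit Types (X Y : {fset {fset K}}) (a b : {fset K}).

Definition is_complex X : Prop :=
  fset0 \in X /\ forall a b, a \in X -> b `<=` a -> b \in X.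

Definition vertices X : {fset K} := \bigcup_(a <- X) a.

(** Dimensions are integers so that the empty face and the complex [{∅}]
    have dimension -1. *)
Definition face_dim a : int := #|` a|%:Z - 1.

Definition complex_dim X : int := (\max_(a <- X) #|` a|)%N%:Z - 1.

Definition neighbourly (l : nat) X : Prop :=
  forall a, a `<=` vertices X -> #|` a| = l -> a \in X.

(** Connectedness of the 1-skeleton, i.e. of the geometric realization. *)
Definition connected_complex X : Prop :=
  forall x y, x \in vertices X -> y \in vertices X ->
    exists p : seq K,
      path (fun u v => [fset u; v] \in X) x p /\ last x p = y.

Definition link X (x : K) : {fset {fset K}} :=
  [fset a in X | (x \notin a) && (x |` a \in X)].

Definition full_simplex a : {fset {fset K}} := fpowerset a.

Definition boundary_simplex a : {fset {fset K}} := fpowerset a `\ a.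

(** Used only when [vertices X] and [vertices Y] are disjoint. *)
Definition join X Y : {fset {fset K}} := [fset a `|` b | a in X, b in Y].

Definition bistellar_move X a b Y : Prop :=
  [/\ a != fset0, b != fset0, [disjoint a & b]
    & face_dim a + face_dim b = complex_dim X] /\
  [/\ [fset c in X | c `<=` a `|` b]
        = join (full_simplex a) (boundary_simplex b)
    & Y = (X `\` join (full_simplex a) (boundary_simplex b))
          `|` join (boundary_simplex a) (full_simplex b)].

End Complexes.

(** In all uses below [L] is inhabited, so the injection on vertices can
    always be extended to a total function. *)
Definition isomorphic {K L : choiceType}
    (X : {fset {fset K}}) (Y : {fset {fset L}}) : Prop :=
  exists f : K -> L,
    {in vertices X &, injective f} /\
    Y = [fset [fset f x | x in a] | a : {fset K} in X].

(** * Stellated complexes *)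

(** Vertices are taken in [nat], which always leaves room for the new vertex
    of a move of index 0. *)
Inductive stellation (k : nat) (d : int) : {fset {fset nat}} -> Prop :=
| StandardSphere (a : {fset nat}) :
    #|` a|%:Z = d + 2 -> stellation k d (boundary_simplex a)
| BistellarStep (X Y : {fset {fset nat}}) (a b : {fset nat}) :
    stellation k d X -> bistellar_move X a b Y -> face_dim b < k%:Z ->
    stellation k d Y.

(** Complexes are identified up to isomorphism.  Bistellar moves preserve the
    PL type, so these complexes are triangulated [d]-spheres. *)
Definition stellated {K : choiceType} (k : nat) (d : int)
    (X : {fset {fset K}}) : Prop :=
  complex_dim X = d /\
  exists Y : {fset {fset nat}}, stellation k d Y /\ isomorphic X Y.

(** The class W_k(d). *)
Definition W_class {K : choiceType} (k : nat) (d : int)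
    (X : {fset {fset K}}) : Prop :=
  [/\ is_complex X, connected_complex X, complex_dim X = d
    & forall x, x \in vertices X -> stellated k (d - 1) (link X x)].

(** * Convex polytopes *)

Section Polytopes.
Context {R : realType} {n : nat}.
Implicit Types (P F : set 'rV[R]_n) (A : {fset 'rV[R]_n}).

Definition conv A : set 'rV[R]_n :=
  [set x | exists w : 'rV[R]_n -> R,
    [/\ forall v, v \in A -> 0 <= w v,
        \sum_(v <- A) w v = 1
      & x = \sum_(v <- A) w v *: v]]%classic.

Definition is_polytope P : Prop := exists A, P = conv A.

(** Faces are cut out by valid linear inequalities; [c = 0] gives the empty
    face and [P] itself. *)
Definition face P F : Prop :=
  exists (c : 'cV[R]_n) (t : R),
    (forall x, P x -> (x *m c) 0 0 <= t) /\
    F = [set x | P x /\ (x *m c) 0 0 = t]%classic.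

Definition proper_face P F : Prop := face P F /\ F <> P.

Definition polytope_vertex P (v : 'rV[R]_n) : Prop := face P [set v]%classic.

Definition affinely_independent A : Prop :=
  forall w : 'rV[R]_n -> R,
    \sum_(v <- A) w v = 0 -> \sum_(v <- A) w v *: v = 0 ->
    forall v, v \in A -> w v = 0.

Definition simplicial_polytope P : Prop :=
  is_polytope P /\
  forall F, proper_face P F ->
    exists A, affinely_independent A /\ F = conv A.

Definition is_boundary_complex P (X : {fset {fset 'rV[R]_n}}) : Prop :=
  forall A, A \in X <->
    (forall v, v \in A -> polytope_vertex P v) /\ proper_face P (conv A).

End Polytopes.

Definition polytopal (R : realType) {K : choiceType}
    (S : {fset {fset K}}) : Prop :=
  exists (n : nat) (P : set 'rV[R]_n) (X : {fset {fset 'rV[R]_n}}),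
    [/\ simplicial_polytope P, is_boundary_complex P X & isomorphic S X].

(* Main.v *)
Require Import Defs.
From mathcomp Require Import classical_sets.
From mathcomp Require Import all_boot all_order all_algebra finmap.
From mathcomp Require Import boolp reals.
From mathcomp Require Import lra ring zify.

Set Implicit Arguments.
Unset Strict Implicit.
Unset Printing Implicit Defensive.

Import Order.TTheory GRing.Theory Num.Theory.
Local Open Scope ring_scope.

(** Let [U] be the space of affine functions restricted to the vertices of the
    polytope; a set [A] of vertices is a face iff some [f] in [U] vanishes on
    [A] and is positive elsewhere.  In a linear dependency among the vertices,
    a face containing the positive part contains the negative part; by
    neighbourliness both parts therefore have at least [k + 2] elements, and
    the vertices are in general position.

    Move a point along a generic segment from the inside of the convex hull of
    the vertices other than [x] to [x], and follow the link of the moving point.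
    It changes only when a facet [B] of that hull is crossed.  Writing the
    crossing point as an affine combination of [B], with positive part [alpha]
    and negative part [beta], the crossing is the bistellar move
    [alpha |-> beta]; the first one creates the boundary of a simplex.  As
    [alpha] is not a face of the original polytope, it has at least [k + 2]
    vertices, whence the index of the move is less than [k]. *)

(** * Real-valued preliminaries *)

(** The step is the inverse of [c], in which the term [m^-1] enforces the bound [m] and makes the
    comparison with each ratio strict. *)
Lemma small_step (R : realFieldType) (I : finType) (P : pred I)
    (a b : I -> R) (m : R) :
  0 < m -> (forall i, P i -> 0 < a i) ->
  exists2 d : R, 0 < d <= m & forall i, P i -> 0 < a i + d * b i.
Proof.
move=> m0 aP; pose c := m^-1 + \sum_(i | P i) `|b i| / a i.
have sge0 i : P i -> 0 <= `|b i| / a i.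
  by move=> Pi; rewrite divr_ge0 // ltW // aP.
have c0 : m^-1 <= c by rewrite lerDl sumr_ge0.
have mi : 0 < m^-1 by rewrite invr_gt0.
have cp : 0 < c by apply: lt_le_trans c0.
exists c^-1.
  by rewrite invr_gt0 cp /= -[leRHS]invrK lef_pV2.
move=> i Pi; have ai := aP i Pi.
have lec : `|b i| / a i < c.
  rewrite /c (bigD1 i) //=.
  have : 0 <= \sum_(j | P j && (j != i)) `|b j| / a j.
    by apply: sumr_ge0 => j /andP[Pj _]; exact: sge0.
  lra.
have : `|b i| < c * a i by rewrite -ltr_pdivrMr.
have := lerNnormlW (lexx `|b i|) => h1 h2.
have h3 : - (c * a i) < b i by lra.
have -> : a i + c^-1 * b i = c^-1 * (c * a i + b i).
  by field; rewrite gt_eqF.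
by rewrite mulr_gt0 ?invr_gt0 //; lra.
Qed.

(** The ratio test of the simplex method: the least [f j / - g j] over [g j < 0] is the first step
    that makes an inequality tight. *)
Lemma min_ratio (R : realFieldType) (I : finType) (P : pred I) (f g : I -> R) :
  (forall i, P i -> 0 <= f i) -> (exists2 i, P i & g i < 0) ->
  exists l, 0 <= l /\ (forall i, P i -> 0 <= f i + l * g i) /\
    exists2 j, P j /\ g j < 0 & f j + l * g j = 0.
Proof.
move=> f0 [i0 Pi0 gi0].
have Qi0 : P i0 && (g i0 < 0) by rewrite Pi0.
have [j /andP[Pj gj] jmin] :=
  @arg_minP _ _ _ i0 (fun i => P i && (g i < 0)) (fun i => f i / - g i) Qi0.
exists (f j / - g j); have fj := f0 j Pj.
have l0 : 0 <= f j / - g j by apply: divr_ge0 => //; lra.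
split=> //; split.
  move=> i Pi; have fi := f0 i Pi.
  have [gi|gi] := ltP (g i) 0.
    have := jmin i; rewrite Pi gi => /(_ isT).
    rewrite ler_pdivlMr; last lra.
    by move=> h; lra.
  have : 0 <= f j / - g j * g i by apply: mulr_ge0.
  lra.
exists j => //; field.
by rewrite lt_eqF.
Qed.

Lemma exists_nonroot (R : realFieldType) (p : {poly R}) :
  p != 0 -> exists2 t : R, 0 < t & p.[t] != 0.
Proof.
move=> p0; pose s := [seq n.+1%:R : R | n <- iota 0 (size p)].
have us : uniq s.
  rewrite map_inj_uniq ?iota_uniq // => m n /eqP.
  by rewrite eqr_nat => /eqP[].
case: (boolP (all (root p) s)) => [al|].
  have := max_poly_roots p0 al us.
  by rewrite size_map size_iota ltnn.
case/allPn => t /mapP[n _ ->] nr; exists n.+1%:R; rewrite ?ltr0n //.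
Qed.

(** With powers of one number [t] as weights, each relevant sum is a nonzero polynomial in [t]; a
    positive non-root of their product serves all of them. *)
Lemma generic_weights (R : realFieldType) (I J : finType) (D : {set I})
    (H : J -> I -> R) :
  exists w : I -> R, (forall i, 0 < w i) /\
    forall j, (exists2 i, i \in D & H j i != 0) ->
      \sum_(i in D) w i * H j i != 0.
Proof.
pose p j : {poly R} := \sum_(i in D) (H j i) *: 'X^(enum_rank i).
have pE j t : (p j).[t] = \sum_(i in D) t ^+ (enum_rank i) * H j i.
  rewrite horner_sum; apply: eq_bigr => i _.
  by rewrite hornerZ hornerXn mulrC.
have : \prod_(j | p j != 0) p j != 0 by apply/prodf_neq0.
case/exists_nonroot => t t0; rewrite horner_prod => /prodf_neq0 pt.
exists (fun i => t ^+ (enum_rank i)); split=> [i|j [i iD Hi]].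
  by rewrite exprn_gt0.
rewrite -pE; apply: pt; apply: contra_neq Hi =>
  /(congr1 (fun q : {poly R} => q`_(enum_rank i))).
rewrite coef0 coef_sum (bigD1 i) //= coefZ coefXn eqxx mulr1 big1 ?addr0 //.
move=> l /andP[_ li]; rewrite coefZ coefXn.
case: eqP => [/ord_inj/enum_rank_inj e|_]; last by rewrite mulr0.
by rewrite e eqxx in li.
Qed.

(** * Function spaces in general position *)

Definition function_space (R : realFieldType) (I : Type)
    (U : (I -> R) -> Prop) : Prop :=
  U (fun=> 0) /\
  forall a b f g, U f -> U g -> U (fun i => a * f i + b * g i).

Lemma function_space_sum (R : realFieldType) (I J : Type)
    (U : (I -> R) -> Prop) (s : seq J) (P : pred J) (a : J -> R) (F : J -> I -> R) :
  function_space U -> (forall j, P j -> U (F j)) ->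
  U (fun i => \sum_(j <- s | P j) a j * F j i).
Proof.
move=> [U0 UD] UF; elim: s => [|j s IH].
  by rewrite (_ : (fun _ => _) = fun=> 0) //; apply/funext => i; rewrite big_nil.
case: (boolP (P j)) => [Pj|nPj].
- rewrite (_ : (fun _ => _) =
      fun i => a j * F j i + 1 * \sum_(l <- s | P l) a l * F l i).
    by apply: UD => //; exact: UF.
  by apply/funext => i; rewrite big_cons Pj mul1r.
- rewrite (_ : (fun _ => _) = fun i => \sum_(l <- s | P l) a l * F l i) //.
  by apply/funext => i; rewrite big_cons (negPf nPj).
Qed.

Section UniformSpace.
Variables (R : realFieldType) (I : finType) (U : (I -> R) -> Prop) (r : nat).

(** [U] is [r]-dimensional and the points of [I] are in general position for it. *)
Definition uniform_space : Prop :=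
  [/\ function_space U,
      forall (B : {set I}) (h : I -> R), (#|B| <= r)%N ->
        exists2 f, U f & forall i, i \in B -> f i = h i
    & forall (B : {set I}) f, (r <= #|B|)%N -> U f ->
        (forall i, i \in B -> f i = 0) -> forall i, f i = 0].

Hypothesis HU : uniform_space.

(** An extra zero outside [B] would be the [r]-th one and force the function to vanish
    everywhere. *)
Lemma uniform_cocircuit (B : {set I}) : #|B|.+1 = r -> (r < #|I|)%N ->
  exists f, [/\ U f, forall i, i \in B -> f i = 0
    & forall i, i \notin B -> f i != 0].
Proof.
case: HU => _ itp unq Br rI.
have /subsetPn[j _ jB] : ~~ ([set: I] \subset B).
  by apply/negP => /subset_leq_card; rewrite cardsT; move: rI Br; lia.
have jB1 : #|j |: B| = r by rewrite cardsU1 jB.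
have [f Uf fE] := itp (j |: B) (fun i => (i == j)%:R) ltac:(by rewrite jB1).
have fB i : i \in B -> f i = 0.
  move=> iB; rewrite fE ?in_setU1 ?iB ?orbT //.
  by case: eqP iB => // ->; rewrite (negPf jB).
exists f; split=> // i iB; apply/negP => /eqP fi.
have : f j = 0.
  apply: (unq (i |: B) f) => //; first by rewrite cardsU1 iB add1n Br.
  by move=> l; rewrite in_setU1 => /orP[/eqP->|/fB].
by move/eqP; rewrite fE ?setU11 // eqxx oner_eq0.
Qed.

(** Generic weights make all hyperplane functions normalisable and let different hyperplanes
    avoiding [x] meet the segment at different points. *)
Lemma uniform_genericity (x : I) : (r < #|I|)%N ->
  exists (w : I -> R) (F : {set I} -> I -> R),
    [/\ forall i, 0 < w i,
        forall B : {set I}, #|B|.+1 = r ->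
          [/\ U (F B), forall i, i \in B -> F B i = 0,
              forall i, i \notin B -> F B i != 0
            & \sum_(i | i != x) w i * F B i = 1]
      & forall A B : {set I}, #|A|.+1 = r -> #|B|.+1 = r ->
          x \notin A -> x \notin B -> F A x = F B x -> A = B].
Proof.
move=> rI.
have /choice[G GP] : forall B : {set I}, exists f, #|B|.+1 = r ->
    [/\ U f, forall i, i \in B -> f i = 0
      & forall i, i \notin B -> f i != 0].
  move=> B.
  have [Br|/eqP Br] := eqVneq #|B|.+1 r; last by exists (fun=> 0).
  by have [f fP] := uniform_cocircuit Br rI; exists f.
(* [inr B] asks for a nonzero weighted sum, to divide by; [inl (A, B)] asks that the normalised
   functions of [A] and [B] differ at [x]. *)
pose H (j : {set I} * {set I} + {set I}) i := match j with
  | inl (A, B) => G A x * G B i - G B x * G A i | inr B => G B i end.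
have [w [w0 wH]] := generic_weights [set~ x] H.
pose W f := \sum_(i in [set~ x]) w i * f i : R.
have WE f : \sum_(i | i != x) w i * f i = W f.
  by apply: eq_bigl => i; rewrite !inE.
have WG (B : {set I}) : #|B|.+1 = r -> W (G B) != 0.
  move=> Br; apply: (wH (inr B)).
  have [_ _ gn] := GP B Br.
  suff /subsetPn[i] : ~~ ([set~ x] \subset B).
    by move=> ix iB; exists i => //=; exact: gn.
  apply/negP => /subset_leq_card; rewrite cardsC1.
  by move: rI Br; lia.
exists w, (fun B i => (W (G B))^-1 * G B i); split=> //.
  move=> B Br; have [Ug g0 gn] := GP B Br; split.
  - case: HU => [[_ UD] _ _].
    have := UD (W (G B))^-1 0 _ _ Ug Ug.
    congr U; apply/funext => i; by rewrite mul0r addr0.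
  - by move=> i /g0 ->; rewrite mulr0.
  - by move=> i /gn g; rewrite mulf_neq0 ?invr_eq0 ?WG.
  - rewrite WE /W -[RHS](mulVf (WG B Br)) mulr_sumr.
    by apply: eq_bigr => i _; rewrite mulrCA.
move=> A B Ar Br xA xB e; apply/eqP; apply: contraT => AB.
have [UA A0 An] := GP A Ar; have [UB B0 Bn] := GP B Br.
have /subsetPn[i iA iB] : ~~ (A \subset B).
  apply: contra AB => AB; rewrite eqEcard AB.
  by move: Ar Br; lia.
have : W (H (inl (A, B))) != 0.
  apply: wH; exists i; first by rewrite !inE; apply: contraNneq xA => <-.
  by rewrite /= (A0 i) // mulr0 subr0 mulf_neq0 ?An ?Bn.
have -> : W (H (inl (A, B))) = G A x * W (G B) - G B x * W (G A).
  rewrite /W !mulr_sumr -sumrB; apply: eq_bigr => l _ /=; ring.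
have := WG A Ar; have := WG B Br => hB hA.
suff -> : G A x = W (G A) * (W (G B))^-1 * G B x.
  have -> : W (G A) * (W (G B))^-1 * G B x * W (G B) - G B x * W (G A) = 0.
    by field.
  by rewrite eqxx.
by rewrite -mulrA -e mulrA mulfV // mul1r.
Qed.

End UniformSpace.

(** * The link of a moving point *)

Section Sweep.
Variables (R : realFieldType) (I : finType) (U : (I -> R) -> Prop) (r : nat).
Variables (x : I) (w : I -> R) (F : {set I} -> I -> R).
Hypothesis HU : uniform_space U r.
Hypothesis rI : (r < #|I|)%N.
Hypothesis w_gt0 : forall i, 0 < w i.

Let W (f : I -> R) := \sum_(i | i != x) w i * f i.

Hypothesis FP : forall B : {set I}, #|B|.+1 = r ->
  [/\ U (F B), forall i, i \in B -> F B i = 0,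
      forall i, i \notin B -> F B i != 0 & W (F B) = 1].

Let UD a b f g : U f -> U g -> U (fun i => a * f i + b * g i).
Proof. by case: HU => [[_ UD] _ _]; exact: UD. Qed.

Let WD a b f g : W (fun i => a * f i + b * g i) = a * W f + b * W g.
Proof.
rewrite /W !mulr_sumr -big_split; apply: eq_bigr => i _ /=; ring.
Qed.

(** The functions vanishing on [r - 1] points form a line, on which [W] reads off the coordinate
    because [W (F B) = 1]. *)
Lemma vanishing_multiple f (B : {set I}) : U f -> #|B|.+1 = r ->
  (forall i, i \in B -> f i = 0) -> forall i, f i = W f * F B i.
Proof.
move=> Uf Br fB; have [UF F0 Fn FW] := FP Br.
have [j jB] : exists j, j \notin B.
  have /subsetPn[j] : ~~ ([set: I] \subset B); last by exists j.
  apply/negP => /subset_leq_card; rewrite cardsT; by move: rI Br; lia.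
have Fj := Fn j jB.
pose h i := 1 * f i + (- (f j / F B j)) * F B i.
have h0 : forall i, h i = 0.
  case: HU => _ _ unq; apply: (unq (j |: B)).
  - by rewrite cardsU1 jB add1n Br.
  - exact: UD.
  - move=> i; rewrite !inE /h => /orP[/eqP->|iB]; first by field.
    by rewrite fB // (F0 i) //; ring.
have : W h = 0 by rewrite /W big1 // => i _; rewrite h0 mulr0.
rewrite WD FW => Wh i.
have := h0 i; rewrite /h.
have -> : f j / F B j = W f by lra.
by move=> hi; lra.
Qed.

(** The link of the point [x + s y], where [y] is the [w]-weighted sum of the
    other points: a function [f] with [W f = 1] vanishes there iff [f x = - s]. *)
Definition sweep_link (s : R) (A : {set I}) : Prop := x \notin A /\ exists f,
  [/\ U f, forall i, i \in A -> f i = 0, forall i, i \notin A -> i != x -> 0 < f i,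
      W f = 1 & f x = - s].

(** These are the facets of the hull of the points other than [x], and the [F B] are the vertices of
    the polyhedron on which the simplex method runs. *)
Definition feasible_basis (B : {set I}) : bool :=
  [&& x \notin B, #|B|.+1 == r & [forall i, (i != x) ==> (0 <= F B i)]].

(** The value of [s] at which [x + s y] lies on the hyperplane through [B]. *)
Definition crossing_level (B : {set I}) : R := - F B x.

Lemma feasibleP B : feasible_basis B ->
  [/\ x \notin B, #|B|.+1 = r & forall i, i != x -> 0 <= F B i].
Proof.
case/and3P => xB /eqP Br /forallP Fp; split=> // i ix.
exact: (implyP (Fp i)).
Qed.

Lemma W_eq0 f : (forall i, i != x -> f i = 0) -> W f = 0.
Proof. by move=> f0; rewrite /W big1 // => i /f0 ->; rewrite mulr0. Qed.

Lemma W_gt0 f j : (forall i, i != x -> 0 <= f i) -> j != x -> 0 < f j -> 0 < W f.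
Proof.
move=> f0 jx fj; rewrite /W (bigD1 j) //= ltr_pwDl ?mulr_gt0 //.
by rewrite sumr_ge0 // => i /andP[ix _]; rewrite mulr_ge0 ?f0 // ltW.
Qed.

Lemma W0_neg f j : W f = 0 -> j != x -> f j != 0 -> exists2 i, i != x & f i < 0.
Proof.
move=> Wf jx fj.
have [/existsP[i /andP[ix fi]]|] := boolP [exists i, (i != x) && (f i < 0)].
  by exists i.
rewrite negb_exists => /forallP al.
have f0 i : i != x -> 0 <= f i.
  by move=> ix; have := al i; rewrite ix /= -leNgt.
have := W_gt0 f0 jx; rewrite Wf ltxx; rewrite lt_neqAle eq_sym fj f0 //= => h.
by have := h isT.
Qed.

Lemma card_zeros f (B : {set I}) : U f -> W f = 1 ->
  (forall i, i \in B -> f i = 0) -> (#|B| < r)%N.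
Proof.
move=> Uf Wf fB; rewrite ltnNge; apply/negP => rB.
case: HU => _ _ unq; have := unq B f rB Uf fB => f0.
by move: Wf; rewrite W_eq0 // => /eqP; rewrite eq_sym oner_eq0.
Qed.

(** Simplex method: as long as [f] is not a vertex, move along a line in the
    kernel of [W] until a further inequality becomes tight. *)
Lemma simplex_walk (e : R) f : U f -> (forall i, i != x -> 0 <= f i) -> W f = 1 ->
  exists B, [/\ feasible_basis B, forall i, i != x -> f i = 0 -> i \in B
    & e * F B x <= e * f x].
Proof.
pose Z (f : I -> R) := [set i | (i != x) && (f i == 0)].
have [n] := ubnP (r - #|Z f|); elim: n f => // n IH f ltn Uf fp Wf.
have Zr : (#|Z f| < r)%N.
  by apply: (card_zeros Uf Wf) => i; rewrite inE => /andP[_ /eqP].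
have [Br|nBr] := eqVneq #|Z f|.+1 r.
  have fE : forall i, f i = F (Z f) i.
    move=> i; rewrite (@vanishing_multiple f (Z f)) ?Wf ?mul1r //.
    by move=> j; rewrite inE => /andP[_ /eqP].
  exists (Z f); rewrite -fE; split=> //.
    rewrite /feasible_basis inE eqxx Br /= eqxx; apply/forallP => i.
    by apply/implyP => ix; rewrite -fE fp.
  by move=> i ix fi; rewrite inE ix fi eqxx.
(* With at most [r - 2] zeros, interpolants at two further points combine to a nonzero [g] in the
   kernel of [W] that vanishes on [Z f]. *)
have [g [Ug gZ Wg [j gj]]] : exists g, [/\ U g, forall i, i \in Z f -> g i = 0,
    W g = 0 & exists j, g j != 0].
  have /subsetPn[j _ jZ] : ~~ ([set: I] \subset Z f).
    by apply/negP => /subset_leq_card; rewrite cardsT; move: rI Zr; lia.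
  have jr : (#|j |: Z f| < r)%N by rewrite cardsU1 jZ; move: Zr nBr; lia.
  have /subsetPn[l _ lZ] : ~~ ([set: I] \subset j |: Z f).
    by apply/negP => /subset_leq_card; rewrite cardsT; move: rI jr; lia.
  case: HU => _ itp _.
  have lr : (#|l |: (j |: Z f)| <= r)%N by rewrite cardsU1 lZ.
  have nZ i (q : I) : q \notin Z f -> i \in Z f -> (i == q) = false.
    by move=> qZ iZ; apply: contraNF qZ => /eqP <-.
  have lj : (l == j) = false by apply: contraNF lZ => /eqP ->; rewrite setU11.
  have lZ' : l \notin Z f by apply: contra lZ => lZ; rewrite in_setU1 lZ orbT.
  have [gj Ugj gjE] := itp _ (fun i => (i == j)%:R) lr.
  have [gl Ugl glE] := itp _ (fun i => (i == l)%:R) lr.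
  have [Wj|Wj] := eqVneq (W gj) 0.
    exists gj; split=> //.
      by move=> i iZ; rewrite gjE ?nZ // in_setU1 in_setU1 iZ !orbT.
    by exists j; rewrite gjE ?eqxx ?oner_eq0 // in_setU1 setU11 orbT.
  exists (fun i => W gj * gl i + (- W gl) * gj i); split.
  - exact: UD.
  - move=> i iZ; have ilj : i \in l |: (j |: Z f) by rewrite in_setU1 in_setU1 iZ !orbT.
    by rewrite gjE // glE // !nZ // !mulr0 addr0.
  - by rewrite WD; ring.
  - exists l; have ll : l \in l |: (j |: Z f) by rewrite in_setU1 eqxx.
    by rewrite gjE // glE // eqxx lj mulr0 addr0 mulr1.
(* Up to the sign of [g], walking along it does not increase [e * f x]. *)
wlog egx : g Ug gZ Wg gj / e * g x <= 0.
  move=> H; have [/H|egx] := leP (e * g x) 0; first exact.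
  apply: (H (fun i => (-1) * g i + 0 * g i)).
  - exact: UD.
  - by move=> i /gZ ->; ring.
  - by rewrite WD Wg; ring.
  - by rewrite mul0r addr0 mulN1r oppr_eq0.
  - lra.
(* At least [r] points differ from [x], so a nonzero [g] cannot vanish at all of them. *)
have [j' j'x gj'] : exists2 j', j' != x & g j' != 0.
  case: HU => _ _ unq.
  have [/existsP[i /andP[]]|] := boolP [exists i, (i != x) && (g i != 0)].
    by exists i.
  rewrite negb_exists => /forallP al.
  have g0 : forall i, g i = 0.
    apply: (unq [set~ x]) => //; first by rewrite cardsC1; move: rI; lia.
    by move=> i; rewrite !inE => ix; have := al i; rewrite ix /= negbK => /eqP.
  by rewrite g0 eqxx in gj.
have [i0 i0x gi0] := W0_neg Wg j'x gj'.
have [//||l [l0 [lp [i1 [i1x gi1] fi1]]]] := @min_ratio _ _ (fun i => i != x) f g.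
  by exists i0.
pose f' i := 1 * f i + l * g i.
have f'E i : f' i = f i + l * g i by rewrite /f' mul1r.
have [||||B [fB ZB le]] := IH f'.
- have : (#|Z f| < #|Z f'|)%N.
    apply: proper_card; apply/properP; split.
      apply/subsetP => i iZ; have gi := gZ i iZ; move: iZ.
      by rewrite !inE f'E gi mulr0 addr0.
    exists i1; first by rewrite inE i1x f'E fi1 eqxx.
    by apply/negP => /gZ e1; rewrite e1 ltxx in gi1.
  by move: ltn Zr; lia.
- exact: UD.
- by move=> i ix; rewrite f'E lp.
- by rewrite /f' WD Wg Wf; ring.
exists B; split=> //.
  move=> i ix fi; apply: ZB => //; rewrite f'E fi gZ ?mulr0 ?addr0 //.
  by rewrite inE ix fi eqxx.
apply: le_trans le _; rewrite f'E mulrDr.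
have := mulr_ge0_le0 l0 egx; lra.
Qed.

(** The sign [e] is the direction of travel. The simplex method gives a feasible basis [B]
    containing [A] whose level is not before [s], hence beyond [s']; a convex combination of the
    witness with [F B] is a witness at [s']. *)
Lemma sweep_shift (e s s' : R) (A : {set I}) : e = 1 \/ e = -1 -> e * s <= e * s' ->
  (forall B, feasible_basis B -> A \subset B ->
     e * crossing_level B < e * s \/ e * s' < e * crossing_level B) ->
  sweep_link s A -> sweep_link s' A.
Proof.
move=> e1 ss' noB [xA [f [Uf fA fp Wf fx]]].
have fge i : i != x -> 0 <= f i.
  by move=> ix; case: (boolP (i \in A)) => [/fA -> //|/fp/(_ ix)/ltW].
have [B [Bf ZB le]] := simplex_walk e Uf fge Wf.
have AB : A \subset B.
  apply/subsetP => i iA; apply: ZB; last exact: fA.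
  by apply: contraNneq xA => <-.
have [xB Br Fp] := feasibleP Bf; have [UF F0 Fn FW] := FP Br.
have leB : e * s <= e * crossing_level B.
  by rewrite /crossing_level; move: le; rewrite fx; lra.
have ltB : e * s' < e * crossing_level B.
  by case: (noB B Bf AB) => //; move: leB; lra.
(* Levels are affine along the segment from [f] to [F B]; [t < 1] keeps a part of [f], hence strict
   positivity off [A]. *)
have [t /andP[t0 t1] tE] : exists2 t, 0 <= t < 1 & t * (crossing_level B - s) = s' - s.
  exists ((s' - s) / (crossing_level B - s)); last first.
    by rewrite mulfVK //; case: e1 ltB leB ss' => ->; move=> *; apply/eqP; lra.
  case: e1 ltB leB ss' => ->; rewrite ?mul1r ?mulN1r => h1 h2 h3.
    have p : 0 < crossing_level B - s by lra.
    by rewrite divr_ge0 ?ltr_pdivrMr ?mul1r //; lra.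
  have p : 0 < - (crossing_level B - s) by lra.
  rewrite -[_ / _]opprK -mulrN -invrN -mulNr.
  by rewrite divr_ge0 ?ltr_pdivrMr ?mul1r //; lra.
split=> //; exists (fun i => (1 - t) * f i + t * F B i); split.
- exact: UD.
- by move=> i iA; rewrite fA // F0 ?(subsetP AB) //; ring.
- move=> i iA ix; have := fp i iA ix; have := Fp i ix => h1 h2.
  have t1' : 0 < 1 - t by lra.
  have := mulr_ge0 t0 h1; have := mulr_gt0 t1' h2; lra.
- by rewrite WD Wf FW; ring.
- by rewrite fx; rewrite /crossing_level in tE; lra.
Qed.

Lemma kernel_interpolation (B : {set I}) (h : I -> R) : #|B|.+1 = r ->
  exists2 e, U e /\ W e = 0 & forall i, i \in B -> e i = h i.
Proof.
move=> Br; have [UF F0 Fn FW] := FP Br.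
case: HU => _ itp _.
have [f Uf fE] := itp B h ltac:(by rewrite -Br).
exists (fun i => 1 * f i + (- W f) * F B i).
  by split; [exact: UD | rewrite WD FW; ring].
by move=> i iB; rewrite fE // F0 //; ring.
Qed.

Lemma kernel_eq0 (B : {set I}) f : #|B|.+1 = r -> U f -> W f = 0 ->
  (forall i, i \in B -> f i = 0) -> forall i, f i = 0.
Proof.
by move=> Br Uf Wf fB i; rewrite (vanishing_multiple Uf Br fB) Wf mul0r.
Qed.

(** Modulo [W], evaluation at [x] is a combination of the evaluations at the
    points of [B], with nonzero coefficients by genericity. *)
Lemma vertex_coefficients (B : {set I}) : #|B|.+1 = r -> x \notin B ->
  exists m : I -> R, (forall u, u \in B -> m u != 0) /\
    forall e, U e -> W e = 0 -> e x = \sum_(u in B) e u * m u.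
Proof.
move=> Br xB.
have /choice[E EP] u : exists e, [/\ U e, W e = 0
    & forall i, i \in B -> e i = (i == u)%:R].
  by have [e [Ue We] eE] := kernel_interpolation (fun i => (i == u)%:R) Br; exists e.
exists (fun u => E u x); split.
  (* If [E u x = 0], then [E u] has weighted sum 0 and zeros at [x] and at the other points of [B],
     so it vanishes, although [E u u = 1]. *)
  move=> u uB; apply/eqP => Eux; have [Ue We eE] := EP u.
  have Cr : #|x |: (B :\ u)|.+1 = r.
    rewrite cardsU1 !inE (negPf xB) andbF add1n.
    by have := cardsD1 u B; rewrite uB; move: Br; lia.
  have := kernel_eq0 Cr Ue We.
  have z : forall i, i \in x |: B :\ u -> E u i = 0.
    move=> i; rewrite !inE => /orP[/eqP -> //|/andP[iu iB]].
    by rewrite eE // (negPf iu).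
  move=> /(_ z u); rewrite eE // eqxx => /eqP; by rewrite oner_eq0.
move=> e Ue We.
pose h i := 1 * e i + (-1) * \sum_(u in B) e u * E u i.
have US : U (fun i => \sum_(u in B) e u * E u i).
  apply: function_space_sum; first by case: HU.
  by move=> u _; case: (EP u).
have WS : W (fun i => \sum_(u in B) e u * E u i) = 0.
  rewrite /W; under eq_bigr do rewrite mulr_sumr.
  rewrite exchange_big big1 //= => u _.
  transitivity (e u * W (E u)); last by case: (EP u) => _ -> _; rewrite mulr0.
  by rewrite /W mulr_sumr; apply: eq_bigr => i _; rewrite mulrCA.
have : h x = 0.
  apply: (kernel_eq0 Br); first exact: UD.
    by rewrite WD We WS; ring.
  move=> i iB; rewrite /h (bigD1 i) //= big1 ?addr0.
    by case: (EP i) => _ _ ->; rewrite // eqxx mul1r mulr1 mulN1r subrr.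
  move=> u /andP[uB ui]; case: (EP u) => _ _ ->; rewrite // eq_sym (negPf ui).
  by rewrite mulr0.
rewrite /h; lra.
Qed.

(** Near the crossing, witnesses are perturbations of [F B] by kernel functions, whose values at [x]
    are read off from [m]. Passing the level of [B] means [e * g x < 0] with [g] zero on [A] and
    nonnegative on [B], so some [u] outside [A] has [e * m u < 0]. *)
Lemma sweep_cross (e s' : R) (B A : {set I}) (m : I -> R) : e = 1 \/ e = -1 ->
  feasible_basis B -> (forall u, u \in B -> m u != 0) ->
  (forall f, U f -> W f = 0 -> f x = \sum_(u in B) f u * m u) ->
  e * crossing_level B < e * s' ->
  (forall C, feasible_basis C -> C != B ->
     e * crossing_level C < e * crossing_level B \/ e * s' < e * crossing_level C) ->
  A \subset B ->
  sweep_link s' A <-> ~ [set u in B | e * m u < 0] \subset A.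
Proof.
move=> e1 Bf mn mE ls noC AB.
have [xB Br Fp] := feasibleP Bf; have [UF F0 Fn FW] := FP Br.
have xA : x \notin A by apply: contra xB; exact: (subsetP AB).
split.
  move=> [_ [f [Uf fA fp Wf fx]]] sub.
  pose g i := 1 * f i + (-1) * F B i.
  have Ug : U g by exact: UD.
  have Wg : W g = 0 by rewrite WD Wf FW; ring.
  have := mE g Ug Wg; rewrite /g => gx.
  have : 0 <= e * \sum_(u in B) (1 * f u + -1 * F B u) * m u.
    rewrite mulr_sumr sumr_ge0 // => u uB; rewrite F0 //.
    have [uA|uA] := boolP (u \in A); first by rewrite fA //; lra.
    have fu : 0 < f u by apply: fp => //; apply: contraNneq xB => <-.
    have mu : 0 <= e * m u.
      rewrite leNgt; apply: contra uA => emu; apply: (subsetP sub).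
      by rewrite inE uB emu.
    have := mulr_ge0 (ltW fu) mu; lra.
  rewrite -gx fx; move: ls; rewrite /crossing_level; case: e1 => ->; lra.
move=> /negP/subsetPn[v]; rewrite inE => /andP[vB mv] vA.
pose C := \sum_(u in B | (u != v) && (u \notin A)) m u.
have m0 : e * m v != 0 by rewrite lt_eqF.
(* The value [M] at [v] is so large that its negative contribution outweighs [C], the total coming
   from the values 1. *)
pose M := (`|C| + 1) / - (e * m v).
have M0 : 0 < M by rewrite divr_gt0 ?ltr_wpDl //; lra.
have [g [Ug Wg] gE] := kernel_interpolation
   (fun u => if u == v then M else (u \notin A)%:R) Br.
have gx : e * g x < 0.
  rewrite (mE g Ug Wg) (bigD1 v) //= gE // eqxx.
  have -> : \sum_(u in B | u != v) g u * m u = C.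
    rewrite /C [LHS]big_mkcondr [RHS]big_mkcondr; apply: eq_bigr => u uB.
    rewrite gE //; case: eqVneq => //= _.
    by case: (u \in A); rewrite ?mul1r ?mul0r.
  have -> : e * (M * m v + C) = - (`|C| + 1) + e * C.
    have <- : M * (e * m v) = - (`|C| + 1).
      by rewrite /M invrN mulrN mulNr mulfVK.
    by ring.
  have : `|e * C| = `|C| by case: e1 => ->; rewrite ?mul1r ?mulN1r ?normrN.
  have := ler_norm (e * C); lra.
have gx0 : - (e * g x) != 0 by apply/eqP; lra.
(* This bound on the step [d] keeps the new level [s] from overshooting [s']; between [s] and [s']
   no level is crossed. *)
have dm0 : 0 < (e * s' - e * crossing_level B) / - (e * g x).
  by rewrite divr_gt0 //; lra.
have [|d /andP[d0 dm] dP] :=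
  @small_step R I (fun i => (i != x) && (i \notin B)) (F B) g _ dm0.
  by move=> i /andP[ix iB]; rewrite lt_neqAle eq_sym Fn //= Fp.
pose s := crossing_level B - d * g x.
have es : e * crossing_level B < e * s.
  rewrite /s; have := mulr_gt0 d0 (_ : 0 < - (e * g x)); lra.
have ess : e * s <= e * s'.
  move: dm; rewrite ler_pdivlMr; last lra.
  rewrite /s; lra.
apply: (@sweep_shift e s) => //.
  move=> D Df _; have [->|DB] := eqVneq D B; first by left.
  by case: (noC D Df DB) => h; [left; lra | right].
split=> //; exists (fun i => 1 * F B i + d * g i); split.
- exact: UD.
- move=> i iA; have iB := subsetP AB i iA; rewrite F0 // gE // iA.
  by case: eqP vA => [<-|_ _]; rewrite ?iA // !mulr0 addr0.
- move=> i iA ix; rewrite mul1r; have [iB|iB] := boolP (i \in B).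
    by rewrite F0 // gE // iA add0r; case: eqP => _; rewrite mulr_gt0.
  by apply: dP; rewrite ix.
- by rewrite WD FW Wg; ring.
- rewrite /s /crossing_level; ring.
Qed.

End Sweep.

(** * Bistellar moves along the segment *)

Section Complexes.
Local Open Scope fset_scope.
Variable K : choiceType.
Implicit Types (X Y : {fset {fset K}}) (a b c : {fset K}).

Lemma in_boundary_simplex a c :
  (c \in boundary_simplex a) = (c `<=` a) && (c != a).
Proof. by rewrite !inE fpowersetE andbC. Qed.

Lemma joinC X Y : join X Y = join Y X.
Proof.
apply/fsetP => c; apply/imfset2P/imfset2P => -[a aX [b bY ->]].
  by exists b => //; exists a => //; rewrite fsetUC.
by exists b => //; exists a => //; rewrite fsetUC.
Qed.

Lemma in_join_full_boundary a b c : [disjoint a & b] ->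
  (c \in join (full_simplex a) (boundary_simplex b))
  = (c `<=` a `|` b) && ~~ (b `<=` c).
Proof.
move=> ab; apply/imfset2P/andP => [[a' aa [b' bb ->]]|[cab bc]].
  move: aa bb; rewrite /= fpowersetE in_boundary_simplex => aa /andP[bb bb'].
  split; first exact: fsetUSS.
  apply: contra bb' => sub; rewrite eqEfsubset bb.
  apply/fsubsetP => i ib; have := fsubsetP sub i ib; rewrite inE.
  case/orP => // /(fsubsetP aa) ia.
  by have := fdisjointP ab i ia; rewrite ib.
exists (c `&` a); first by rewrite /= fpowersetE fsubsetIr.
exists (c `&` b); last by rewrite -fsetIUr; apply/esym/fsetIidPl.
rewrite /= in_boundary_simplex fsubsetIr /=.
by apply: contra bc => /eqP <-; exact: fsubsetIl.
Qed.

Lemma bistellar_moveP X Y a b :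
  a != fset0 -> b != fset0 -> [disjoint a & b] ->
  (face_dim a + face_dim b)%R = complex_dim X ->
  (forall c, c `<=` a `|` b -> (c \in X) = ~~ (b `<=` c)) ->
  (forall c, c `<=` a `|` b -> (c \in Y) = ~~ (a `<=` c)) ->
  (forall c, ~~ (c `<=` a `|` b) -> (c \in Y) = (c \in X)) ->
  bistellar_move X a b Y.
Proof.
move=> a0 b0 ab dm Xab Yab XY; split=> //; split.
  apply/fsetP => c; rewrite in_join_full_boundary // !inE /= andbC.
  by case: (boolP (c `<=` _)) => //= cab; rewrite Xab.
apply/fsetP => c; rewrite 2!inE [join (boundary_simplex a) _]joinC.
rewrite (in_join_full_boundary c ab).
rewrite in_join_full_boundary 1?fdisjoint_sym // [b `|` a]fsetUC.
have [cab|cab] := boolP (c `<=` _); last by rewrite XY //= orbF.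
by rewrite Yab // Xab //=; case: (b `<=` c).
Qed.

Lemma complex_dimE X n : (forall a, a \in X -> (#|` a| <= n)%N) ->
  (exists2 a, a \in X & #|` a| = n) -> complex_dim X = (n%:Z - 1)%R.
Proof.
move=> le [a aX an]; rewrite /complex_dim; congr (Posz _ - 1)%R.
apply/eqP; rewrite eqn_leq; apply/andP; split.
  by apply/bigmax_leqP_seq => b bX _; exact: le.
by rewrite -an; apply: (@leq_bigmax_seq _ _ _ (fun a => #|` a|) a).
Qed.

Lemma complex_dim_card X n : complex_dim X = n%:Z ->
  (forall a, a \in X -> (#|` a| <= n.+1)%N) /\
  exists2 a, a \in X & #|` a| = n.+1.
Proof.
rewrite /complex_dim => e.
have {}e : (\max_(a <- X) #|` a|)%N = n.+1 by move: e; lia.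
have le a : a \in X -> (#|` a| <= n.+1)%N.
  by move=> aX; rewrite -e; apply: (@leq_bigmax_seq _ _ _ (fun a => #|` a|) a).
split=> //; apply: contrapT => no.
suff : (\max_(a <- X) #|` a| <= n)%N by rewrite e ltnn.
apply/bigmax_leqP_seq => a aX _; have := le a aX.
by rewrite leq_eqVlt => /orP[/eqP an|//]; case: no; exists a.
Qed.

End Complexes.

(** * Index sets encoded as faces over another vertex type *)

Section Encoding.
Variables (I : finType) (L : choiceType) (c : I -> L).
Hypothesis c_inj : injective c.
Implicit Types (A B : {set I}).

Definition fset_of_set (A : {set I}) : {fset L} := [fset c i | i in A]%fset.
Notation enc := fset_of_set.

Lemma mem_fset_of_set A i : (c i \in enc A) = (i \in A).
Proof.
apply/imfsetP/idP => [[j jA /c_inj ->] //|iA]; by exists i.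
Qed.

Lemma fset_of_set_sub A B : (enc A `<=` enc B)%fset = (A \subset B).
Proof.
apply/fsubsetP/subsetP => sub => [i iA|l /imfsetP[i iA ->]].
  by rewrite -mem_fset_of_set sub // mem_fset_of_set.
by rewrite mem_fset_of_set sub.
Qed.

Lemma fset_of_set_inj : injective enc.
Proof. by move=> A B e; apply/setP => i; rewrite -!mem_fset_of_set e. Qed.

Lemma card_fset_of_set A : #|` enc A| = #|A|.
Proof. by rewrite card_imfset //= cardE. Qed.

Lemma fset_of_setU A B : enc (A :|: B) = (enc A `|` enc B)%fset.
Proof.
apply/fsetP => l; rewrite inE; apply/imfsetP/orP => [[i /=]|].
  by rewrite inE => /orP[] iAB ->; [left|right]; rewrite mem_fset_of_set.
by case=> /imfsetP[i /= iA ->]; exists i; rewrite //= inE iA ?orbT.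
Qed.

Lemma fset_of_set_onto (l : {fset L}) B : (l `<=` enc B)%fset ->
  exists2 A : {set I}, A \subset B & l = enc A.
Proof.
move=> lB; exists [set i | c i \in l].
  by apply/subsetP => i; rewrite inE => /(fsubsetP lB); rewrite mem_fset_of_set.
apply/fsetP => j; apply/idP/imfsetP => [jl|[i /=]]; last first.
  by rewrite inE => ? ->.
have /imfsetP[i _ e] := fsubsetP lB j jl.
by exists i => //=; rewrite inE -e.
Qed.

Lemma fset_of_set_disjoint A B : A :&: B = set0 -> [disjoint enc A & enc B]%fset.
Proof.
move=> /setP AB; apply/fdisjointP => l /imfsetP[i /= iA ->].
rewrite mem_fset_of_set; apply/negP => iB.
by have := AB i; rewrite !inE iA iB.
Qed.

Definition complex_of (P : {set I} -> Prop) : {fset {fset L}} :=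
  [fset enc A | A in [set A : {set I} | `[< P A >]]]%fset.

Lemma mem_complex_of P A : enc A \in complex_of P = `[< P A >].
Proof.
apply/imfsetP/idP => [[B /=]|PA]; first by rewrite inE => PB /fset_of_set_inj ->.
by exists A; rewrite //= inE.
Qed.

Lemma complex_ofP P l :
  reflect (exists2 A : {set I}, P A & l = enc A) (l \in complex_of P).
Proof.
apply: (iffP idP) => [/imfsetP[A /=]|[A PA ->]].
  by rewrite inE => /asboolP PA ->; exists A.
by rewrite mem_complex_of; apply/asboolP.
Qed.

End Encoding.

(** * Crossing a facet is a bistellar move of small index *)

Section SweepStellation.
Variables (R : realFieldType) (I : finType) (U : (I -> R) -> Prop) (k : nat).
Variables (x : I) (w : I -> R) (F : {set I} -> I -> R).
(** A polytope bounded by a sphere of dimension [2 * k + 1] spans dimension [2 * k + 2], where the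
    affine functions have dimension [2 * k + 3]. *)
Let r := (2 * k).+3.
Hypothesis HU : uniform_space U r.
Hypothesis rI : (r < #|I|)%N.
Hypothesis w_gt0 : forall i, 0 < w i.
Let W (f : I -> R) := \sum_(i | i != x) w i * f i.
Hypothesis FP : forall B : {set I}, #|B|.+1 = r ->
  [/\ U (F B), forall i, i \in B -> F B i = 0,
      forall i, i \notin B -> F B i != 0 & W (F B) = 1].
Hypothesis F_inj : forall A B : {set I}, #|A|.+1 = r -> #|B|.+1 = r ->
  x \notin A -> x \notin B -> F A x = F B x -> A = B.
Hypothesis neighb : forall A : {set I}, (#|A| <= k.+1)%N ->
  exists f, [/\ U f, forall i, i \in A -> f i = 0 & forall i, i \notin A -> 0 < f i].
Variable c : I -> nat.
Hypothesis c_inj : injective c.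

Local Notation sweep := (sweep_link U x w).
Local Notation feasible := (feasible_basis r x F).
Local Notation level := (crossing_level x F).
Local Notation enc := (fset_of_set c).
Local Notation complex s := (complex_of c (sweep s)).

Let UD a b f g : U f -> U g -> U (fun i => a * f i + b * g i).
Proof. by case: HU => [[_ UD] _ _]; exact: UD. Qed.

Let WD a b f g : W (fun i => a * f i + b * g i) = a * W f + b * W g.
Proof.
rewrite /W !mulr_sumr -big_split; apply: eq_bigr => i _ /=; ring.
Qed.

Lemma level_inj B C : feasible B -> feasible C -> level B = level C -> B = C.
Proof.
move=> /feasibleP[xB Br _] /feasibleP[xC Cr _] /oppr_inj; exact: F_inj.
Qed.

(** A witness for a set of [r - 1] points equals [F A], so that [A] would be a feasible basis of
    level [s]. *)
Lemma sweep_card s A : (forall B, feasible B -> level B != s) -> sweep s A ->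
  (#|A| <= (2 * k).+1)%N.
Proof.
move=> ncrit [xA [f [Uf fA fp Wf fx]]].
have := card_zeros HU Uf Wf fA; rewrite /r !ltnS leq_eqVlt => /orP[/eqP Ar|//].
have fE i : f i = F A i.
  by rewrite (vanishing_multiple HU rI FP Uf _ fA) ?Ar // Wf mul1r.
have Af : feasible A.
  rewrite /feasible_basis xA Ar eqxx; apply/forallP => i; apply/implyP => ix.
  by rewrite -fE; case: (boolP (i \in A)) => [/fA ->|/fp/(_ ix)/ltW].
by have := ncrit A Af; rewrite /crossing_level -fE fx opprK eqxx.
Qed.

(** The positive coefficients span the face [alpha] destroyed by the crossing;
    at a positive level it is not a face of the polytope. *)
Lemma positive_coefficients_card B (m : I -> R) : feasible B -> 0 < level B ->
  (forall f, U f -> W f = 0 -> f x = \sum_(u in B) f u * m u) ->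
  (k.+1 < #|[set u in B | (0 < m u)%R]|)%N.
Proof.
move=> Bf lB mE; rewrite ltnNge; apply/negP => /neighb[f [Uf f0 fp]].
have [xB Br Fp] := feasibleP Bf; have [UF F0 Fn FW] := FP Br.
set A := [set u in B | 0 < m u] in f0 fp *.
have [j jx jA] : exists2 j, j != x & j \notin A.
  have /subsetPn[j _] : ~~ ([set: I] \subset x |: B).
    apply/negP => /subset_leq_card; rewrite cardsT cardsU1 xB.
    by move: rI Br; lia.
  rewrite in_setU1 negb_or => /andP[jx jB]; exists j => //.
  by apply: contra jB; rewrite inE => /andP[].
have fge i : 0 <= f i by case: (boolP (i \in A)) => [/f0 ->|/fp/ltW].
have Wf : 0 < W f.
  by apply: (@W_gt0 _ _ _ _ w_gt0 f j) => //; exact: fp.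
(* The normalised supporting function minus [F B] lies in the kernel of [W]. Its value at [x] is
   positive, as [f x] and the level are, whereas [mE] makes it nonpositive because [f] vanishes
   where [m] is positive. *)
pose g i := (W f)^-1 * f i + (-1) * F B i.
have Wg : W g = 0 by rewrite WD FW; field; rewrite gt_eqF.
have := mE g (UD _ _ Uf UF) Wg; rewrite /g => gx.
have : \sum_(u in B) ((W f)^-1 * f u + -1 * F B u) * m u <= 0.
  apply: sumr_le0 => u uB; rewrite F0 // mulr0 addr0.
  have [uA|uA] := boolP (u \in A); first by rewrite f0 // mulr0 mul0r.
  have mu : m u <= 0 by move: uA; rewrite inE uB /= -leNgt.
  by apply: mulr_ge0_le0 => //; rewrite mulr_ge0 // invr_ge0 ltW.
rewrite -gx => gx0.
have xA : x \notin A by rewrite inE (negPf xB).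
have : 0 < (W f)^-1 * f x by rewrite mulr_gt0 ?invr_gt0 ?fp.
move: lB; rewrite /crossing_level; lra.
Qed.

(** Induction on the number of levels above [s]. Starting from the empty complex inside the hull,
    every crossing on the way down to [s] either creates the boundary of a simplex or is an
    admissible move. *)
Lemma stellation_sweep s : 0 <= s -> (forall B, feasible B -> level B != s) ->
  (forall A, ~ sweep s A) \/
  stellation k (2 * k)%N%:Z (complex s) /\
    exists2 A : {set I}, sweep s A & #|A| = (2 * k).+1.
Proof.
have [n] := ubnP #|[set B : {set I} | feasible B && (s < level B)%R]|.
elim: n s => // n IH s ltn s0 ncrit.
have [/existsP[B0 B0f]|/existsPn noB] :=
    boolP [exists B, feasible B && (s < level B)]; last first.
  (* Without levels above [s] nothing is swept: the simplex method would give a feasible basis of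
     level at least [s]. *)
  left=> A [xA [f [Uf fA fp Wf fx]]].
  have fge i : i != x -> 0 <= f i.
    by move=> ix; case: (boolP (i \in A)) => [/fA -> //|/fp/(_ ix)/ltW].
  have [B [Bf _ le]] := simplex_walk HU rI w_gt0 FP 1 Uf fge Wf.
  have := noB B; rewrite Bf /= lt_neqAle eq_sym ncrit //=.
  by move: le; rewrite fx /crossing_level; lra.
have [B /andP[Bf sB] Bmin] : exists2 B : {set I}, feasible B && (s < level B)
    & forall C, feasible C && (s < level C) -> level B <= level C.
  have [B BP Bmin] := @arg_minP _ _ _ B0
    (fun B => feasible B && (s < level B)) level B0f.
  by exists B.
have [xB Br Fp] := feasibleP Bf; have [UF F0 Fn FW] := FP Br.
have Bk : #|B| = (2 * k).+2 by case: Br.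
(* The level [s2] lies just above that of [B], so that [B] alone is crossed between [s2] and [s]. *)
have [|d /andP[d0 _] dP] := @small_step R {set I}
  (fun C => feasible C && (level B < level C))
  (fun C => level C - level B) (fun=> -1) 1 ltr01.
  by move=> C /andP[_]; lra.
set s2 := level B + d.
have above C : feasible C -> level B < level C -> s2 < level C.
  by move=> Cf BC; have := dP C; rewrite Cf BC /s2 => /(_ isT); lra.
have below C : feasible C -> C != B -> level C <= level B -> level C < s.
  move=> Cf CB CBl; rewrite lt_neqAle ncrit //= leNgt; apply/negP => sC.
  have := Bmin C; rewrite Cf sC => /(_ isT) BC.
  by case/eqP: CB; apply: level_inj => //; apply/eqP; rewrite eq_le CBl BC.
have s2crit C : feasible C -> level C != s2.
  move=> Cf; have [CB|BC] := leP (level C) (level B).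
    by rewrite lt_eqF // /s2; lra.
  by rewrite gt_eqF // above.
have s20 : 0 <= s2 by rewrite /s2; lra.
have IHs : (#|[set C : {set I} | feasible C && (s2 < level C)%R]| < n)%N.
  rewrite -ltnS; apply: leq_trans ltn; rewrite ltnS; apply: proper_card.
  apply/properP; split.
    by apply/subsetP => C; rewrite !inE => /andP[-> /=]; rewrite /s2; lra.
  by exists B; rewrite !inE Bf ?sB //= /s2 -leNgt; lra.
have {IH IHs} := IH s2 IHs s20 s2crit.
have [m [mn mE]] := vertex_coefficients HU rI FP Br xB.
(* [a] and [b] carry the positive and the negative coefficients. The subsets of [B] in the complex
   are those not containing [a] below the level of [B], and those not containing [b] above it. *)
pose a := [set u in B | -1 * m u < 0]; pose b := [set u in B | 1 * m u < 0].
have aB : a \subset B by apply/subsetP => u; rewrite inE => /andP[].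
have bB : b \subset B by apply/subsetP => u; rewrite inE => /andP[].
have hi (A : {set I}) : A \subset B -> sweep s2 A <-> ~ b \subset A.
  move=> AB; apply: (sweep_cross HU rI w_gt0 FP _ Bf mn mE) => //.
  - by left.
  - by rewrite /s2; lra.
  - move=> C Cf CB; rewrite !mul1r; have [le|/(above C Cf)] := leP (level C) (level B).
      by left; apply: lt_trans sB; exact: below.
    by right.
have lo (A : {set I}) : A \subset B -> sweep s A <-> ~ a \subset A.
  move=> AB; apply: (sweep_cross HU rI w_gt0 FP _ Bf mn mE) => //.
  - by right.
  - lra.
  - move=> C Cf CB; have [le|lt] := leP (level C) (level B); last by left; lra.
    by right; have := below C Cf CB le; lra.
have off (A : {set I}) : ~~ (A \subset B) -> sweep s A <-> sweep s2 A.
  move=> AB; split.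
    apply: (sweep_shift HU rI w_gt0 FP (or_introl (erefl (1 : R)))).
      by rewrite /s2; lra.
    move=> C Cf AC; have CB : C != B by apply: contraNneq AB => <-.
    rewrite !mul1r; have [le|/(above C Cf)] := leP (level C) (level B).
      by left; exact: below.
    by right.
  apply: (sweep_shift HU rI w_gt0 FP (or_intror (erefl (-1 : R)))).
    by rewrite /s2; lra.
  move=> C Cf AC; have CB : C != B by apply: contraNneq AB => <-.
  have [le|/(above C Cf)] := leP (level C) (level B); last by left; lra.
  by right; have := below C Cf CB le; lra.
have ak : (k.+1 < #|a|)%N.
  rewrite (_ : a = [set u in B | 0 < m u]); last first.
    by apply/setP => u; rewrite !inE; congr (_ && _); lra.
  by apply: positive_coefficients_card => //; apply: le_lt_trans sB.
have ab0 : a :&: b = set0.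
  apply/setP => u; rewrite !inE; apply/negP => /andP[/andP[_ h1] /andP[_ h2]]; lra.
have abB : a :|: b = B.
  apply/setP => u; rewrite !inE -andb_orr; case: (boolP (u \in B)) => //= uB.
  have := mn u uB; rewrite neq_lt => /orP[] h; apply/orP; [right|left]; lra.
have abr : (#|a| + #|b| = (2 * k).+2)%N.
  by rewrite -cardsUI ab0 abB cards0 addn0.
have remove u (e : {set I}) : u \in e -> u \in B ->
    ~ e \subset B :\ u /\ #|B :\ u| = (2 * k).+1.
  move=> ue uB; split; first by move/subsetP/(_ u ue); rewrite !inE eqxx.
  by move: Bk; rewrite (cardsD1 u B) uB add1n => -[].
have wit : exists2 A : {set I}, sweep s A & #|A| = (2 * k).+1.
  have [u ua] : exists u, u \in a.
    by apply/set0Pn; rewrite -card_gt0; apply: leq_trans ak.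
  have [na ca] := remove u a ua (subsetP aB u ua).
  by exists (B :\ u) => //; apply/lo => //; exact: subsetDl.
case=> [none|[st [A0 A0s _]]].
  (* An empty complex lacks even the empty face, so [b] is empty and [a] is all of [B]: the boundary
     of a simplex appears. *)
  have b0 : b = set0.
    apply/eqP; apply: contraT => b0; exfalso; apply: (none set0).
    by apply/hi; rewrite ?sub0set // subset0; apply/negP.
  have aBE : a = B by rewrite -abB b0 setU0.
  right; split=> //.
  suff -> : complex s = boundary_simplex (enc B).
    by apply: StandardSphere; rewrite card_fset_of_set // Bk -addn2 PoszD.
  apply/fsetP => l; rewrite in_boundary_simplex; apply/complex_ofP/andP => //.
    move=> [A As ->]; rewrite fset_of_set_sub //.
    have AB : A \subset B.
      by apply: contraT => nAB; case: (none A); apply/off.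
    split=> //; apply/eqP => /(fset_of_set_inj c_inj) e.
    by case/(lo A AB): As; rewrite e aBE.
  case=> /(fset_of_set_onto c_inj)[A AB ->] nA; exists A => //; apply/lo => //.
  rewrite aBE => BA; case/eqP: nA; congr enc; apply/eqP.
  by rewrite eqEsubset AB.
have b0 : b != set0.
  (* If no coefficient were negative, [B] would have the highest level of all feasible bases, and
     nothing could be swept at [s2]. *)
  apply/eqP => b0; case: A0s => [_ [f [Uf fA fp Wf fx]]].
  have fge i : i != x -> 0 <= f i.
    by move=> ix; case: (boolP (i \in A0)) => [/fA -> //|/fp/(_ ix)/ltW].
  have [C [Cf _ le]] := simplex_walk HU rI w_gt0 FP 1 Uf fge Wf.
  have [xC Cr Cp] := feasibleP Cf; have [UC _ _ CW] := FP Cr.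
  have Wg : W (fun i => 1 * F C i + -1 * F B i) = 0 by rewrite WD CW FW; ring.
  have := mE _ (UD 1 (-1) UC UF) Wg.
  have : 0 <= \sum_(u in B) (1 * F C u + -1 * F B u) * m u.
    apply: sumr_ge0 => u uB; rewrite F0 // mulr0 addr0 mul1r.
    have mu : 0 <= m u.
      rewrite leNgt; apply/negP => h; have : u \in b by rewrite inE uB mul1r.
      by rewrite b0 inE.
    by rewrite mulr_ge0 ?Cp //; apply: contraNneq xB => <-.
  move=> h e; move: le; rewrite fx /s2 /crossing_level; lra.
right; split=> //; apply: (BistellarStep (a := enc a) (b := enc b) st); last first.
  (* Since [a] has at least [k + 2] of the [2 * k + 2] points of [B], at most [k] are left for
     [b]. *)
  by rewrite /face_dim card_fset_of_set //; move: ak abr; clear; lia.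
apply: bistellar_moveP.
- by rewrite -cardfs_gt0 card_fset_of_set //; apply: leq_trans ak.
- by rewrite -cardfs_gt0 card_fset_of_set // card_gt0.
- exact: fset_of_set_disjoint.
- rewrite (@complex_dimE _ _ (2 * k).+1).
  + by rewrite /face_dim !card_fset_of_set //; move: abr; clear; lia.
  + move=> l /(complex_ofP c_inj)[A As ->]; rewrite card_fset_of_set //.
    exact: sweep_card As.
  + have [u ub] : exists u, u \in b by apply/set0Pn.
    have [nb cb] := remove u b ub (subsetP bB u ub).
    exists (enc (B :\ u)); last by rewrite card_fset_of_set.
    rewrite mem_complex_of //; apply/asboolP/hi => //; exact: subsetDl.
- move=> l; rewrite -fset_of_setU // abB => /(fset_of_set_onto c_inj)[A AB ->].
  rewrite mem_complex_of // fset_of_set_sub //.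
  by apply/asboolP/negP => /(hi A AB).
- move=> l; rewrite -fset_of_setU // abB => /(fset_of_set_onto c_inj)[A AB ->].
  rewrite mem_complex_of // fset_of_set_sub //.
  by apply/asboolP/negP => /(lo A AB).
- move=> l; rewrite -fset_of_setU // abB => lB.
  apply/complex_ofP/complex_ofP => // -[A As e]; exists A => //;
    by apply/off; rewrite // -(fset_of_set_sub c_inj) -e.
Qed.

End SweepStellation.

(** * Exposed faces of neighbourly configurations *)

Section ExposedFaces.
Variables (R : realFieldType) (I : finType) (U : (I -> R) -> Prop).

(** These are the proper faces, with [f] the slack of a supporting hyperplane; excluding the full
    set discards the zero function. *)
Definition exposed (A : {set I}) : Prop := A != setT /\
  exists f, [/\ U f, forall i, i \in A -> f i = 0 & forall i, i \notin A -> 0 < f i].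

(** At level 0 the moving point is [x] itself, so the sweep ends at the link of [x]. With exactly
    [2 * k + 3] points the polytope is a simplex and is treated directly. *)
Theorem stellation_link (k : nat) (x : I) (c : I -> nat) :
  uniform_space U (2 * k).+3 -> injective c -> ((2 * k).+3 <= #|I|)%N ->
  (forall A : {set I}, (#|A| <= k.+1)%N -> exposed A) ->
  stellation k (2 * k)%N%:Z
    (complex_of c (fun A => x \notin A /\ exposed (x |: A))) /\
  exists A : {set I}, [/\ x \notin A, exposed (x |: A) & #|A| = (2 * k).+1].
Proof.
move=> HU c_inj; rewrite leq_eqVlt => /orP[/eqP Ir _|rI neighb].
  have C1 : #|[set~ x]| = (2 * k).+2 by rewrite cardsC1 -Ir.
  have ex (A : {set I}) : A != setT -> exposed A.
    move=> AT; split=> //; case: HU => _ itp _.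
    have [|f Uf fE] := itp setT (fun i => (i \notin A)%:R).
      by rewrite cardsT Ir.
    by exists f; split=> // i iA; rewrite fE ?inE // iA ?ltr01.
  split; last first.
    have [y yx] : exists y, y != x.
      have /set0Pn[y] : [set~ x] != set0 by rewrite -card_gt0 C1.
      by rewrite !inE; exists y.
    exists ([set~ x] :\ y); split; first by rewrite !inE eqxx andbF.
      apply/ex/eqP => /setP/(_ y); by rewrite !inE eqxx (negPf yx).
    by have := cardsD1 y [set~ x]; rewrite C1 !inE yx => -[].
  suff -> : complex_of c (fun A => x \notin A /\ exposed (x |: A))
      = boundary_simplex (fset_of_set c [set~ x]).
    by apply: StandardSphere; rewrite card_fset_of_set // C1; lia.
  have xT (A : {set I}) : x |: A = setT -> [set~ x] \subset A.
    by move/setP => e; apply/subsetP => i; have := e i; rewrite !inE => /orP[->|].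
  apply/fsetP => l; rewrite in_boundary_simplex; apply/complex_ofP/andP => //.
    case=> A [xA [AT _]] ->; rewrite fset_of_set_sub //; split.
      by apply/subsetP => i iA; rewrite !inE; apply: contraNneq xA => <-.
    apply: contra AT => /eqP/(fset_of_set_inj c_inj) ->.
    by apply/eqP/setP => i; rewrite !inE orbN.
  case=> /(fset_of_set_onto c_inj)[A Ax ->] nA; exists A => //; split.
    by apply/negP => /(subsetP Ax); rewrite !inE eqxx.
  apply/ex/eqP => /xT xA; case/eqP: nA; congr (fset_of_set c _).
  by apply/eqP; rewrite eqEsubset Ax.
have [w [F [w0 FP F_inj]]] := uniform_genericity HU x rI.
have sweepE : sweep_link U x w 0 = fun A => x \notin A /\ exposed (x |: A).
  apply/funext => A; apply/propext; split=> -[xA].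
    case=> f [Uf fA fp Wf]; rewrite oppr0 => fx; split=> //.
    have f0 i : i \in x |: A -> f i = 0.
      by rewrite in_setU1 => /orP[/eqP->|/fA].
    split.
      have := card_zeros HU Uf Wf f0; apply: contraTneq => ->.
      by rewrite cardsT -leqNgt ltnW.
    exists f; split=> // i; rewrite in_setU1 negb_or => /andP[ix iA]; exact: fp.
  case=> AT [f [Uf f0 fp]]; split=> //.
  have /subsetPn[j _ jA] : ~~ ([set: I] \subset x |: A) by rewrite subTset.
  pose W (f : I -> R) := \sum_(i | i != x) w i * f i.
  have Wf : 0 < W f.
    apply: (@W_gt0 _ _ _ _ w0 f j); last exact: fp.
    - by move=> i _; case: (boolP (i \in x |: A)) => [/f0 ->|/fp/ltW].
    - by apply: contraNneq jA => ->; rewrite setU11.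
  have Wi : 0 < (W f)^-1 by rewrite invr_gt0.
  exists (fun i => (W f)^-1 * f i + 0 * f i); split.
  - by case: HU => [[_ UD] _ _]; exact: UD.
  - by move=> i iA; rewrite f0 ?in_setU1 ?iA ?orbT //; ring.
  - move=> i iA ix; rewrite mul0r addr0 mulr_gt0 // fp //.
    by rewrite in_setU1 negb_or ix.
  - rewrite -[RHS](mulVf (lt0r_neq0 Wf)) /W mulr_sumr.
    by apply: eq_bigr => i _; rewrite mul0r addr0 mulrCA.
  - by rewrite f0 ?setU11 //; ring.
rewrite -sweepE.
have [||none|[st [A As Ar]]] := @stellation_sweep R I U k x w F HU rI w0 FP F_inj
   _ c c_inj 0 (lexx 0).
- by move=> A Ak; case: (neighb A Ak).
- move=> B /feasibleP[xB Br _]; case: (FP B Br) => _ _ Fn _.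
  by rewrite oppr_eq0 Fn.
(* The complex is not empty, because [x] alone is exposed. *)
- case: (none set0); rewrite sweepE inE setU0; split=> //.
  by apply: neighb; rewrite cards1.
- split=> //; exists A; move: As; rewrite sweepE => -[xA ex]; split=> //.
Qed.

Lemma wide_kernel (C D : {set I}) (h : I -> I -> R) : (#|D| < #|C|)%N ->
  exists z : I -> R, (exists2 j, j \in C & z j != 0) /\
    forall a, a \in D -> \sum_(j in C) z j * h j a = 0.
Proof.
move=> DC; have [j0 j0C] : exists j, j \in C.
  by apply/set0Pn; rewrite -card_gt0; apply: leq_ltn_trans DC.
pose M := \matrix_(i < #|C|, l < #|D|) h (enum_val i) (enum_val l).
have kM : kermx M != 0.
  rewrite kermx_eq0 /row_free; apply/eqP => e.
  by have := rank_leq_col M; rewrite e leqNgt DC.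
have [v v0 vM] : exists2 v : 'rV_#|C|, v != 0 & v *m M = 0.
  by exists (nz_row (kermx M)); [rewrite nz_row_eq0 | apply/sub_kermxP/nz_row_sub].
exists (fun i => v 0 (enum_rank_in j0C i)); split.
  have /rV0Pn[i vi] := v0.
  by exists (enum_val i); rewrite ?enum_valP // enum_valK_in.
move=> a aD.
transitivity ((v *m M) 0 (enum_rank_in aD a)); last by rewrite vM mxE.
rewrite mxE [LHS]big_enum_val; apply: eq_bigr => i _.
by rewrite mxE enum_valK_in enum_rankK_in.
Qed.

(** * Neighbourliness forces general position *)

Hypothesis HU : function_space U.
Hypothesis U1 : U (fun=> 1).

Let UD a b f g : U f -> U g -> U (fun i => a * f i + b * g i).
Proof. by case: HU => _ UD; exact: UD. Qed.

(** Points are added one at a time: either some function vanishing at the earlier points corrects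
    the value at the new point [j], or evaluation at [j] is a combination of the earlier
    evaluations. *)
Lemma interpolation_or_dependency (C : {set I}) :
  (forall h : I -> R, exists2 f, U f & forall i, i \in C -> f i = h i) \/
  exists l : I -> R, (exists2 i, i \in C & l i != 0) /\
    forall f, U f -> \sum_(i in C) l i * f i = 0.
Proof.
have [n] := ubnP #|C|; elim: n C => // n IH C; rewrite ltnS => Cn.
have [->|/set0Pn[j jC]] := eqVneq C set0.
  by left=> h; exists (fun=> 1) => // i; rewrite inE.
have [|itp|[l [[i iC li] lU]]] := IH (C :\ j).
- by move: Cn; rewrite (cardsD1 j C) jC.
- have [[f [Uf f0 fj]]|none] := pselect (exists f,
      [/\ U f, forall i, i \in C :\ j -> f i = 0 & f j != 0]).
    left=> h; have [f0' Uf0 f0E] := itp h.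
    exists (fun i => 1 * f0' i + ((h j - f0' j) / f j) * f i); first exact: UD.
    move=> i iC; have [->|ij] := eqVneq i j; first by field.
    have iCj : i \in C :\ j by rewrite !inE ij.
    by rewrite f0E // (f0 i) //; ring.
  have /choice[E EP] u : exists e, U e /\
      forall i, i \in C :\ j -> e i = (i == u)%:R.
    by have [e Ue eE] := itp (fun i => (i == u)%:R); exists e.
  right; exists (fun i => if i == j then -1 else E i j); split.
    by exists j => //; rewrite eqxx oppr_eq0 oner_eq0.
  move=> f Uf.
  pose S := fun i => \sum_(u in C :\ j) f u * E u i.
  have US : U S by apply: function_space_sum => // u _; case: (EP u).
  have fj : 1 * f j + (-1) * S j = 0.
    apply: contrapT => /eqP fj; apply: none.
    exists (fun i => 1 * f i + (-1) * S i); split=> //; first exact: UD.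
    move=> i iC; rewrite /S (bigD1 i) //= big1 ?addr0.
      by case: (EP i) => _ ->; rewrite // eqxx mulr1 mul1r mulN1r subrr.
    move=> u /andP[uC ui]; case: (EP u) => _ ->; rewrite // eq_sym (negPf ui).
    by rewrite mulr0.
  rewrite (bigD1 j) //= eqxx.
  have -> : \sum_(i in C | i != j) (if i == j then -1 else E i j) * f i = S j.
    rewrite /S; apply: eq_big => [i|i /andP[_ /negPf ->]]; last by rewrite mulrC.
    by rewrite !inE andbC.
  lra.
- right; exists (fun i => if i == j then 0 else l i); move: iC.
  rewrite !inE => /andP[ij iC]; split; first by exists i; rewrite // (negPf ij).
  move=> f Uf; rewrite (bigD1 j) //= eqxx mul0r add0r -[RHS](lU f Uf).
  apply: eq_big => [u|u /andP[_ /negPf -> //]]; by rewrite !inE andbC.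
Qed.

Variable k : nat.
Hypothesis exposedS : forall A B : {set I}, exposed A -> B \subset A -> exposed B.
Hypothesis neighb : forall A : {set I}, #|A| = k.+1 -> exposed A.
Hypothesis small : forall A, exposed A -> (#|A| <= (2 * k).+2)%N.
Variable top : {set I}.
Hypothesis top_ex : exposed top.
Hypothesis top_card : #|top| = (2 * k).+2.

Lemma card_top_ltn : ((2 * k).+3 <= #|I|)%N.
Proof.
case: top_ex => nT _; rewrite -top_card -cardsT; apply: proper_card.
by rewrite properT.
Qed.

Lemma exposed_small (A : {set I}) : (#|A| <= k.+1)%N -> exposed A.
Proof.
move=> Ak.
have : (k.+1 - #|A| <= #|~: A|)%N.
  by have := cardsC A; have := card_top_ltn; lia.
case/card_geqP => s [us ss sA].
apply: (@exposedS (A :|: [set i in s])); last exact: subsetUl.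
apply: neighb; rewrite cardsU.
have -> : A :&: [set i in s] = set0.
  apply/setP => i; rewrite !inE; apply/negP => /andP[iA /sA].
  by rewrite !inE iA.
rewrite cards0 subn0 cardsE (card_uniqP us) ss; lia.
Qed.

(** A face containing the positive part of a dependency contains the negative
    part as well, and one of the two parts has at most [k+1] elements. *)
Lemma no_dependency (C : {set I}) (l : I -> R) : (#|C| <= (2 * k).+3)%N ->
  (forall f, U f -> \sum_(i in C) l i * f i = 0) -> forall i, i \in C -> l i = 0.
Proof.
move=> Cr.
wlog pos : l / (#|[set i in C | (0 < l i)%R]| <= k.+1)%N.
  move=> H lU; pose P := [set i in C | 0 < l i]; pose N := [set i in C | l i < 0].
  have PN : (#|P| + #|N| <= #|C|)%N.
    rewrite -cardsUI (_ : P :&: N = set0) ?cards0 ?addn0.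
      by apply/subset_leq_card/subsetP => i; rewrite !inE -andb_orr => /andP[].
    apply/setP => i; rewrite !inE; apply/negP => /andP[/andP[_ h1] /andP[_ h2]]; lra.
  have [Pk|Pk] := leqP #|P| k.+1; first exact: H.
  move=> i iC; apply/eqP; rewrite -oppr_eq0; apply/eqP.
  apply: (H (fun i => - l i)) => //.
    rewrite (_ : [set i in C | 0 < - l i] = N); last first.
      by apply/setP => j; rewrite !inE oppr_gt0.
    by move: PN Cr Pk; lia.
  move=> f Uf; transitivity (- \sum_(j in C) l j * f j); last by rewrite lU ?oppr0.
  by rewrite -sumrN; apply: eq_bigr => j _; rewrite mulNr.
move=> lU; have [_ [f [Uf f0 fp]]] := exposed_small pos.
have le0 i : i \in C -> l i * f i <= 0.
  move=> iC; have [iP|iP] := boolP (i \in [set i in C | 0 < l i]).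
    by rewrite f0 // mulr0.
  have fi := fp i iP; move: iP; rewrite inE iC /= -leNgt => li.
  by apply: mulr_le0_ge0 => //; exact: ltW.
(* Nonpositive terms with sum 0 all vanish; as [f] is positive off the positive part, no coefficient
   is negative. *)
have eq0 i : i \in C -> l i * f i = 0.
  move=> iC; apply/eqP; rewrite -oppr_eq0; apply/eqP.
  apply: (psumr_eq0P (P := mem C) (F := fun i => - (l i * f i))) => //.
    by move=> j jC; rewrite oppr_ge0 le0.
  by rewrite sumrN lU // oppr0.
have ge0 i : i \in C -> 0 <= l i.
  move=> iC; rewrite leNgt; apply/negP => li.
  have iP : i \notin [set i in C | 0 < l i] by rewrite inE iC /= -leNgt ltW.
  have := eq0 i iC; have := fp i iP => fi /eqP.
  by rewrite mulf_eq0 (gt_eqF fi) (lt_eqF li).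
(* On the constant function 1 the dependency says that the nonnegative coefficients sum to 0. *)
move=> i iC; apply: (psumr_eq0P (P := mem C)) => //.
by rewrite -[RHS](lU _ U1); apply: eq_bigr => j _; rewrite mulr1.
Qed.

Lemma interpolation (C : {set I}) (h : I -> R) : (#|C| <= (2 * k).+3)%N ->
  exists2 f, U f & forall i, i \in C -> f i = h i.
Proof.
move=> Cr; case: (interpolation_or_dependency C) => [|[l [[i iC li] lU]]]; first exact.
by case/eqP: li; exact: (no_dependency Cr lU).
Qed.

(** Otherwise the space is too large for [top] to be a facet, and tilting its
    supporting functional yields a larger exposed face. *)
Lemma neighbourly_uniform : uniform_space U (2 * k).+3.
Proof.
split=> //; first by move=> B h; exact: interpolation.
move=> B0 f B0r Uf fB0 j; apply: contrapT => /eqP fj.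
have [B [Br fB]] : exists B : {set I}, #|B| = (2 * k).+3 /\
    forall i, i \in B -> f i = 0.
  case/card_geqP: B0r => s [us ss sB]; exists [set i in s].
  rewrite cardsE (card_uniqP us) ss; split=> // i; rewrite inE => /sB; exact: fB0.
have jB : j \notin B by apply: contra fj => /fB ->.
pose C := j |: B.
have Cc : #|C| = (2 * k).+4 by rewrite cardsU1 jB Br.
(* As [f] vanishes on [B] but not at [j], values can be prescribed on all [2 * k + 4] points of
   [C]. *)
have /choice[E EP] u : exists e, U e /\ forall i, i \in C -> e i = (i == u)%:R.
  have [g Ug gE] := interpolation (fun i => (i == u)%:R) (eq_leq Br).
  exists (fun i => 1 * g i + (((j == u)%:R - g j) / f j) * f i); split.
    exact: UD.
  move=> i; rewrite in_setU1 => /orP[/eqP->|iB]; first by field.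
  by rewrite gE // (fB i) // mulr0 addr0 mul1r.
case: top_ex => nT [ft [Uft ft0 ftp]].
have /subsetPn[u _ uT] : ~~ ([set: I] \subset top) by rewrite subTset.
(* [top] with the extra point [u] is smaller than [C], so a nonzero combination [g] of the [E u]
   vanishes on it. *)
have DC : (#|u |: top| < #|C|)%N by rewrite Cc cardsU1 uT top_card.
have [z [[a aC za] zD]] := wide_kernel E DC.
pose g i := \sum_(u in C) z u * E u i.
have Ug : U g by apply: function_space_sum => // v _; case: (EP v).
have ga : g a != 0.
  rewrite /g (bigD1 a) //= big1 ?addr0.
    by case: (EP a) => _ ->; rewrite // eqxx mulr1.
  move=> v /andP[vC va]; case: (EP v) => _ ->; rewrite // eq_sym (negPf va).
  by rewrite mulr0.
have gD : forall i, i \in u |: top -> g i = 0 by move=> i /zD.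
wlog ga_neg : g Ug ga gD {zD} / g a < 0.
  move=> H; move: (ga); rewrite neq_lt => /orP[?|ga0]; first exact: (H g).
  apply: (H (fun i => (-1) * g i + 0 * g i));
    rewrite ?mul0r ?addr0 ?mulN1r ?oppr_eq0 //.
  - exact: UD.
  - by move=> i /gD ->; ring.
  - lra.
(* Tilt [ft] along [g] until a point outside [top] becomes tight; [g u = 0] keeps [u] off the new
   face, which is proper yet larger than [top]. *)
have [||l [l0 [lp [i1 [_ gi1] fi1]]]] := @min_ratio _ _ predT ft g.
- by move=> i _; case: (boolP (i \in top)) => [/ft0 ->|/ftp/ltW].
- by exists a.
pose f' i := 1 * ft i + l * g i.
have f'E i : f' i = ft i + l * g i by rewrite /f' mul1r.
pose Z := [set i | f' i == 0].
have tZ : i1 |: top \subset Z.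
  apply/subsetP => i; rewrite in_setU1 inE f'E => /orP[/eqP->|iT].
    by rewrite fi1 eqxx.
  by rewrite ft0 // gD ?in_setU1 ?iT ?orbT // mulr0 addr0 eqxx.
have i1T : i1 \notin top.
  by apply/negP => iT; move: gi1; rewrite gD ?ltxx // in_setU1 iT orbT.
have /small : exposed Z.
  split; last exists f'; first apply/eqP => /setP/(_ u).
    rewrite !inE f'E gD ?setU11 // mulr0 addr0 => /eqP e.
    by have := ftp u uT; rewrite e ltxx.
  split; first exact: UD.
    by move=> i; rewrite inE => /eqP.
  by move=> i; rewrite inE f'E => iZ; rewrite lt_neqAle eq_sym iZ lp.
move=> Zk; have := leq_trans (subset_leq_card tZ) Zk.
by rewrite cardsU1 i1T top_card add1n ltnn.
Qed.

End ExposedFaces.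

(** * Polytopes *)

Section Geometry.
Variables (R : realType) (n : nat).
Implicit Types (A B : {fset 'rV[R]_n}) (u v p : 'rV[R]_n) (c : 'cV[R]_n).
Local Notation "u '.*' c" := ((u *m c) 0 0) (at level 40).

Let dotD u v c : (u + v) .* c = u .* c + v .* c.
Proof. by rewrite mulmxDl mxE. Qed.

Let dotZ (a : R) u c : (a *: u) .* c = a * (u .* c).
Proof. by rewrite -scalemxAl mxE. Qed.

Let dotB u v c : (u - v) .* c = u .* c - v .* c.
Proof. by rewrite mulmxBl !mxE. Qed.

Let dot_sum (J : Type) (s : seq J) (P : pred J) (F : J -> 'rV[R]_n) c :
  (\sum_(j <- s | P j) F j) .* c = \sum_(j <- s | P j) F j .* c.
Proof. by rewrite mulmx_suml summxE. Qed.

Let dotDr u c d : u .* (c + d) = u .* c + u .* d.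
Proof. by rewrite mulmxDr mxE. Qed.

Let dotZr u (a : R) c : u .* (a *: c) = a * (u .* c).
Proof. by rewrite -scalemxAr mxE. Qed.

(** Induction on [s]. If the functional [c] found for the tail is not positive at [a i], the other
    vectors are combined with [a i] into vectors orthogonal to [c], and the alternative is applied
    to these. *)
Lemma gordan (J : eqType) (s : seq J) (a : J -> 'rV[R]_n) : uniq s ->
  (exists c, forall j, j \in s -> 0 < a j .* c) \/
  exists l : J -> R, [/\ forall j, j \in s -> 0 <= l j,
    exists2 j, j \in s & 0 < l j & \sum_(j <- s) l j *: a j = 0].
Proof.
elim: s a => [|i s IH] a; first by left; exists 0.
rewrite [uniq _]/= => /andP[is_ us].
have out (T : Type) (f : J -> T) (t : T) j :
    j \in s -> (if j == i then t else f j) = f j.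
  by case: eqP => // -> ii; rewrite ii in is_.
have [a0|a0] := eqVneq (a i) 0.
  right; exists (fun j => (j == i)%:R); split.
  - by move=> j _; rewrite ler0n.
  - by exists i; rewrite ?mem_head // eqxx ltr01.
  - rewrite big_cons a0 scaler0 add0r big_seq big1 // => j js.
    by case: eqP js => [->|]; rewrite ?(negPf is_) // scale0r.
case: (IH a us) => [[c cP]|[l [l0 [j js lj] ls]]]; last first.
  right; exists (fun j => if j == i then 0 else l j); split.
  - by move=> j'; rewrite inE; case: eqP => //= _; exact: l0.
  - by exists j; rewrite ?inE ?js ?orbT // out.
  - rewrite big_cons eqxx scale0r add0r -[RHS]ls big_seq [RHS]big_seq.
    by apply: eq_bigr => j' js'; rewrite out.
have [ci|ci] := ltP 0 (a i .* c).
  by left; exists c => j; rewrite inE => /orP[/eqP->|/cP].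
pose q := - (a i .* c).
have q0 : 0 <= q by rewrite /q; lra.
case: (IH (fun j => q *: a j + (a j .* c) *: a i) us) => [[d dP]|].
  (* [e] is 0 at [a i] and positive at the other vectors; adding a small multiple of [a i] makes it
     positive at [a i] too. *)
  left; pose e := q *: d + (a i .* d) *: c.
  have ai0 : a i .* e = 0 by rewrite /e dotDr !dotZr /q; ring.
  have aje j : j \in s -> 0 < a j .* e.
    by move=> js; have := dP j js; rewrite dotD !dotZ /e dotDr !dotZr; lra.
  have : 0 < a i .* (a i)^T.
    rewrite mxE; have /rV0Pn[t at0] := a0.
    rewrite (bigD1 t) //= mxE ltr_pwDl //.
      by rewrite -expr2 exprn_even_gt0.
    by apply: sumr_ge0 => t' _; rewrite mxE -expr2 sqr_ge0.
  set z := (a i)^T => az.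
  have [|d' /andP[d0 _] dP'] := @small_step R 'I_(size s) predT
    (fun t => a (nth i s t) .* e) (fun t => a (nth i s t) .* z) 1 ltr01.
    by move=> t _; apply: aje; exact: mem_nth.
  exists (e + d' *: z) => j; rewrite dotDr dotZr inE => /orP[/eqP->|js].
    by rewrite ai0 add0r mulr_gt0.
  have lt : (index j s < size s)%N by rewrite index_mem.
  by have := dP' (Ordinal lt) isT; rewrite /= nth_index.
case=> l [l0 [j js lj] ls]; right.
pose li := \sum_(j <- s) l j * (a j .* c).
exists (fun j => if j == i then li else q * l j).
have li0 : 0 < li.
  rewrite /li (bigD1_seq j) //= ltr_pwDl ?mulr_gt0 ?cP //.
  rewrite big_seq_cond sumr_ge0 // => t /andP[ts _].
  by rewrite mulr_ge0 ?l0 // ltW // cP.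
split.
- move=> t; rewrite inE; case: eqP => //= _; first by rewrite ltW.
  by move=> ts; rewrite mulr_ge0 // l0.
- by exists i; rewrite ?mem_head // eqxx.
- transitivity (\sum_(j <- s) l j *: (q *: a j + (a j .* c) *: a i)); last by [].
  rewrite big_cons eqxx /li scaler_suml -big_split /= big_seq [RHS]big_seq.
  apply: eq_bigr => t ts; rewrite (out _ (fun t => q * l t)) // scalerDr !scalerA addrC.
  by rewrite [q * _]mulrC.
Qed.

Lemma conv_sub A B p : (forall v, v \in A -> conv B v) -> conv A p -> conv B p.
Proof.
move=> AB [w [w0 w1 pE]].
have /choice[m mP] : forall v, exists m : 'rV[R]_n -> R, v \in A ->
    [/\ forall u, u \in B -> 0 <= m u, \sum_(u <- B) m u = 1
      & v = \sum_(u <- B) m u *: u].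
  move=> v; have [vA|nvA] := boolP (v \in A); last by exists (fun=> 0).
  by have [m mP] := AB v vA; exists m.
exists (fun u => \sum_(v <- A) w v * m v u); split.
- move=> u uB; rewrite big_seq sumr_ge0 // => v vA.
  by rewrite mulr_ge0 ?w0 //; case: (mP v vA) => m0 _ _; exact: m0.
- rewrite exchange_big -[RHS]w1 big_seq [RHS]big_seq; apply: eq_bigr => v vA.
  by rewrite -mulr_sumr; case: (mP v vA) => _ -> _; rewrite mulr1.
- under eq_bigr do rewrite scaler_suml.
  rewrite exchange_big pE big_seq [RHS]big_seq; apply: eq_bigr => v vA.
  case: (mP v vA) => _ _ vE; rewrite [X in _ *: X = _]vE scaler_sumr.
  by apply: eq_bigr => u _; rewrite scalerA.
Qed.

Lemma mem_conv A v : v \in A -> conv A v.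
Proof.
move=> vA; exists (fun u => (u == v)%:R); split.
- by move=> u _; rewrite ler0n.
- rewrite (bigD1_seq v) ?fset_uniq //= eqxx big1 ?addr0 // => u /negPf -> //.
- rewrite (bigD1_seq v) ?fset_uniq //= eqxx scale1r big1 ?addr0 // => u /negPf ->.
  by rewrite scale0r.
Qed.

(** The slack [t - p .* c] is the weighted sum of the slacks of the points of [A]; if it is 0, only
    points with slack 0 carry weight. *)
Lemma conv_tight A c (t : R) p : (forall v, v \in A -> v .* c <= t) ->
  conv A p -> p .* c <= t /\ (p .* c = t ->
    conv [fset v in A | v .* c == t]%fset p).
Proof.
move=> le [w [w0 w1 pE]].
have tE : t - p .* c = \sum_(v <- A) w v * (t - v .* c).
  under eq_bigr do rewrite mulrBr.
  rewrite sumrB -mulr_suml w1 mul1r pE dot_sum; congr (_ - _).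
  by apply: eq_bigr => v _; rewrite dotZ.
have ge v : v \in A -> 0 <= w v * (t - v .* c).
  by move=> vA; rewrite mulr_ge0 ?w0 // subr_ge0 le.
split; first by rewrite -subr_ge0 tE big_seq sumr_ge0.
move=> pt; have w_eq0 v : v \in A -> v .* c != t -> w v = 0.
  move=> vA vt; move: tE; rewrite pt subrr (bigD1_seq v) ?fset_uniq //= => /eqP.
  rewrite eq_sym paddr_eq0 ?ge //; last first.
    by rewrite big_seq_cond sumr_ge0 // => u /andP[uA _]; exact: ge.
  case/andP; rewrite mulf_eq0 subr_eq0 [t == _]eq_sym (negPf vt) orbF.
  by move/eqP.
have sub (V : zmodType) (F : 'rV[R]_n -> V) :
    (forall v, v \in A -> v .* c != t -> F v = 0) ->
    \sum_(v <- [fset v in A | v .* c == t]%fset) F v = \sum_(v <- A) F v.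
  move=> F0; rewrite [RHS](big_fsetID _ (fun v => v .* c == t)) /=.
  rewrite [X in _ + X]big_seq [X in _ + X]big1 ?addr0 // => v.
  by rewrite !inE => /andP[]; exact: F0.
exists w; split.
- by move=> v; rewrite !inE => /andP[/w0].
- by rewrite sub // => v vA vt; exact: w_eq0.
- rewrite pE sub // => v vA vt; by rewrite w_eq0 // scale0r.
Qed.

Lemma conv0 p : ~ conv fset0 p.
Proof.
by case=> w [_ /eqP]; rewrite big_seq_fset0 eq_sym oner_eq0.
Qed.

Lemma polytope_vertex_mem P A v : polytope_vertex P v ->
  (forall u, u \in A -> P u) -> conv A v -> v \in A.
Proof.
move=> [c [t [le vE]]] AP cv.
have [_ tight] := conv_tight (fun u uA => le u (AP u uA)) cv.
have vP : P v /\ v .* c = t.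
  by have : [set v]%classic v by []; rewrite vE.
have := tight vP.2; set B := [fset u in A | _]%fset => Bv.
have [B0|/fset0Pn[u]] := eqVneq B fset0; first by move: Bv; rewrite B0 => /conv0.
rewrite !inE => /andP[uA /eqP ut].
have : [set v]%classic u by rewrite vE; split=> //; exact: AP.
by move=> /= <-.
Qed.

(** Krein-Milman for polytopes: a minimal generating set consists of exposed
    points. *)
Lemma polytope_generators P : is_polytope P ->
  exists A, P = conv A /\ forall v, v \in A -> polytope_vertex P v.
Proof.
move=> [A0 PE].
have [A [AE Amin]] : exists A, conv A = P /\
    forall v, v \in A -> ~ conv (A `\ v)%fset v.
  have [m] := ubnP #|` A0|; elim: m A0 PE => // m IH A PE lt.
  have [[v [vA vc]]|none] := pselect (exists v, v \in A /\ conv (A `\ v)%fset v).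
    apply: (IH (A `\ v)%fset).
      rewrite PE; apply/funext => p; apply/propext; split; apply: conv_sub.
        move=> u uA; have [->//|uv] := eqVneq u v.
        by apply: mem_conv; rewrite !inE uv.
      by move=> u; rewrite !inE => /andP[_ uA]; exact: mem_conv.
    by move: lt; rewrite (cardfsD1 v A) vA.
  by exists A; split=> // v vA vc; apply: none; exists v.
exists A; split=> // v vA; rewrite -AE.
have us : uniq (enum_fset (A `\ v)%fset) by exact: fset_uniq.
(* For the differences [v - u], the first alternative is a functional maximal at [v] only; the
   second writes [v] as a convex combination of the other generators, against minimality. *)
have [[c cP]|[l [l0 [j js lj] ls]]] := gordan (fun u => v - u) us.
  have le u : u \in A -> u .* c <= v .* c.
    move=> uA; have [->//|uv] := eqVneq u v.
    by have := cP u; rewrite !inE uv uA dotB => /(_ isT); lra.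
  exists c, (v .* c); split.
    by move=> p /(conv_tight le)[].
  apply/funext => p; apply/propext; split.
    by move=> ->; split=> //; exact: mem_conv.
  case=> /(conv_tight le)[_ tight] /tight.
  set B := [fset u in A | _]%fset => Bp.
  have BE u : u \in B -> u = v.
    rewrite !inE => /andP[uA /eqP e]; apply/eqP; apply: contraT => uv.
    by have := cP u; rewrite !inE uv uA dotB e subrr ltxx => /(_ isT).
  case: Bp => w [_ w1 ->] /=.
  have -> : \sum_(u <- B) w u *: u = \sum_(u <- B) w u *: v.
    by rewrite big_seq [RHS]big_seq; apply: eq_bigr => u /BE ->.
  by rewrite -scaler_suml w1 scale1r.
case: (Amin v vA).
pose s := \sum_(u <- (A `\ v)%fset) l u.
have s0 : 0 < s.
  rewrite /s (bigD1_seq j) //= ltr_pwDl //.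
  by rewrite big_seq_cond sumr_ge0 // => u /andP[us' _]; exact: l0.
exists (fun u => s^-1 * l u); split.
- by move=> u us'; rewrite mulr_ge0 ?l0 // invr_ge0 ltW.
- by rewrite -mulr_sumr mulVf ?gt_eqF.
- under eq_bigr do rewrite -scalerA.
  rewrite -scaler_sumr; apply: (scalerI (a := s)); first by rewrite gt_eqF.
  rewrite scalerA mulfV ?gt_eqF // scale1r /s scaler_suml; apply/eqP.
  rewrite -subr_eq0 -sumrB -[X in _ == X]ls; apply/eqP; apply: eq_bigr => u _.
  by rewrite scalerBr.
Qed.

End Geometry.

(** * Faces of a polytopal sphere as exposed vertex sets *)

Lemma in_vertices (K : choiceType) (X : {fset {fset K}}) y :
  reflect (exists2 a, a \in X & y \in a) (y \in vertices X).
Proof.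
apply: (iffP (bigfcupP _ _ _ _)) => [[a /andP[aX _] ya]|[a aX ya]]; exists a => //.
by rewrite aX.
Qed.

Lemma face_sub_vertices (K : choiceType) (X : {fset {fset K}}) a :
  a \in X -> (a `<=` vertices X)%fset.
Proof. by move=> aX; apply/fsubsetP => y ya; apply/in_vertices; exists a. Qed.

Section Faces.
Variables (K : choiceType) (S : {fset {fset K}}).
Notation enc := (fset_of_set (fun i : vertices S => val i)).

Lemma face_fset_of_set a : a \in S -> exists A : {set vertices S}, a = enc A.
Proof.
move=> aS; suff /(@fset_of_set_onto (vertices S) _ _ val_inj)[A _ ->] :
    (a `<=` enc setT)%fset by exists A.
apply/fsubsetP => y ya; have yV := fsubsetP (face_sub_vertices aS) y ya.
by apply/imfsetP; exists [` yV]%fset; rewrite //= inE.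
Qed.

Lemma fset_of_set1U (i : vertices S) (A : {set vertices S}) :
  enc (i |: A) = (val i |` enc A)%fset.
Proof.
rewrite fset_of_setU; last exact: val_inj.
congr (_ `|` _)%fset; apply/fsetP => y; rewrite inE; apply/imfsetP/eqP => [[j /=]|->].
  by rewrite inE => /eqP ->.
by exists i; rewrite //= inE.
Qed.

(** [U] consists of the affine functions restricted to the vertices of the polytope. A face with two
    vertices excludes a polytope that is a single point, whose only vertex is not a proper face. *)
Lemma polytopal_exposed (R : realType) : polytopal R S ->
  (exists2 a, a \in S & (1 < #|` a|)%N) ->
  exists U : (vertices S -> R) -> Prop, [/\ function_space U, U (fun=> 1)
    & forall A : {set vertices S}, enc A \in S <-> exposed U A].
Proof.
case=> n [P [X [[polyP _] bd [g [ginj XE]]]]] [a aS a2].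
have [Q [PE Qv]] := polytope_generators polyP.
pose gI (i : vertices S) := g (val i).
have gI_inj : injective gI.
  by move=> i j /ginj e; apply: val_inj; apply: e; exact: valP.
have vP v : polytope_vertex P v -> P v.
  case=> c [t [_ vE]]; have : [set v]%classic v by [].
  by rewrite vE => -[].
have vgI i : polytope_vertex P (gI i).
  have /in_vertices[b bS ib] := valP i.
  have : [fset g z | z in b]%fset \in X by rewrite XE; apply/imfsetP; exists b.
  by case/bd => + _; apply; apply/imfsetP; exists (val i).
have gIP i : P (gI i) by apply: vP.
have Psingle v : P <> [set v]%classic.
  move=> Pv; have [A aE] := face_fset_of_set aS.
  move: a2; rewrite aE card_fset_of_set; last exact: val_inj.
  case/card_gt1P => i [j [_ _]]; case/eqP; apply: gI_inj.
  by have := gIP i; have := gIP j; rewrite Pv /= => -> ->.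
have QgI v : v \in Q -> exists i, v = gI i.
  move=> vQ; have : [fset v]%fset \in X.
    apply/bd; split; first by move=> u; rewrite inE => /eqP ->; exact: Qv.
    have -> : conv [fset v]%fset = [set v]%classic.
      apply/funext => p; apply/propext; split.
        by case=> w [_]; rewrite !big_seq_fset1 => -> ->; rewrite scale1r.
      by move=> ->; apply: mem_conv; rewrite inE.
    by split; [exact: Qv | move=> e; exact: (@Psingle v)].
  rewrite XE => /imfsetP[b /= bS bE]; have [A AE] := face_fset_of_set bS.
  have : v \in [fset v]%fset by rewrite inE.
  rewrite bE AE => /imfsetP[z /= /imfsetP[i /= _ ->] ->]; by exists i.
pose img := fset_of_set gI.
have imgE (A : {set vertices S}) : img A = [fset g z | z in enc A]%fset.
  apply/fsetP => v; apply/imfsetP/imfsetP =>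
    [[i /= iA ->]|[z /= /imfsetP[i /= iA ->] ->]].
    by exists (val i) => //; apply/imfsetP; exists i.
  by exists i.
have imgP (A : {set vertices S}) u : u \in img A -> P u.
  by case/imfsetP => i _ ->.
have convP B p : (forall u, u \in B -> P u) -> conv B p -> P p.
  by move=> BP; rewrite PE; apply: conv_sub => u /BP; rewrite PE.
have encS (A : {set vertices S}) : enc A \in S <-> proper_face P (conv (img A)).
  split=> [AS|pf].
    have : img A \in X by rewrite XE imgE; apply/imfsetP; exists (enc A).
    by case/bd.
  have : img A \in X.
    by apply/bd; split=> // v /imfsetP[i _ ->]; exact: vgI.
  rewrite XE => /imfsetP[b /= bS]; have [B BE] := face_fset_of_set bS.
  rewrite BE -imgE => /(fset_of_set_inj gI_inj) ->.
  by rewrite -BE.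
exists (fun h => exists (c : 'cV[R]_n) (t : R),
  forall i, h i = t - (gI i *m c) 0 0); split.
- split; first by exists 0, 0 => i; rewrite mulmx0 mxE subrr.
  move=> r s f h [c [t fE]] [d [u hE]]; exists (r *: c + s *: d), (r * t + s * u) => i.
  by rewrite fE hE mulmxDr -!scalemxAr !mxE; ring.
- by exists 0, 1 => i; rewrite mulmx0 mxE subr0.
move=> A; apply: (iff_trans (encS A)); split.
  case=> -[c [t [le FE]]] nP; split.
    apply/eqP => AT; apply: nP; apply/funext => p; apply/propext; split.
      by apply: convP => u; exact: imgP.
    rewrite {1}PE; apply: conv_sub => u /QgI[i ->]; apply: mem_conv.
    by rewrite mem_fset_of_set // AT inE.
  exists (fun i => t - (gI i *m c) 0 0); split.
  - by exists c, t.
  - move=> i iA; have : conv (img A) (gI i).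
      by apply: mem_conv; rewrite mem_fset_of_set.
    by rewrite FE => -[_ ->]; rewrite subrr.
  - move=> i iA; rewrite subr_gt0 lt_neqAle le // andbT.
    apply: contra iA => /eqP e; have : conv (img A) (gI i) by rewrite FE.
    move/(polytope_vertex_mem (vgI i) (@imgP A)).
    by rewrite mem_fset_of_set.
case=> AT [f [[c [t fE]] f0 fp]].
have le i : (gI i *m c) 0 0 <= t.
  rewrite -subr_ge0 -fE; by case: (boolP (i \in A)) => [/f0 ->|/fp/ltW].
have Qle v : v \in Q -> (v *m c) 0 0 <= t by case/QgI => i ->.
have imgt p : conv (img A) p -> (p *m c) 0 0 = t.
  move=> pA.
  have on v : v \in img A -> (v *m c) 0 0 = t.
    by case/imfsetP => i /= iA ->; have := f0 i iA; rewrite fE; lra.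
  (* The bounds for [c] and for [- c] together give equality. *)
  have [|h1 _] := @conv_tight _ _ (img A) c t p _ pA; first by move=> v /on ->.
  have [|h2 _] := @conv_tight _ _ (img A) (- c) (- t) p _ pA.
    by move=> v /on e; rewrite mulmxN mxE e.
  by move: h2; rewrite mulmxN mxE; lra.
split.
  exists c, t; split; first by move=> p; rewrite PE => /(conv_tight Qle)[].
  apply/funext => p; apply/propext; split.
    by move=> pA; split; [apply: convP pA => u; exact: imgP | exact: imgt].
  case; rewrite {1}PE => /(conv_tight Qle)[_ tight] /tight.
  apply: conv_sub => u; rewrite !inE => /andP[/QgI[i ->] /eqP e].
  apply: mem_conv; rewrite mem_fset_of_set //; apply: contraT => /fp.
  by rewrite fE e subrr ltxx.
move=> e; have /subsetPn[j _ jA] : ~~ ([set: vertices S]%SET \subset A).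
  by rewrite subTset.
have := gIP j; rewrite -e => /imgt ej.
by have := fp j jA; rewrite fE ej subrr ltxx.
Qed.

End Faces.

(** * Connectedness and vertex links of the sphere *)

Lemma stellation_index0 (d : int) X : stellation 0 d X ->
  exists2 a : {fset nat}, #|` a|%:Z = d + 2 & X = boundary_simplex a.
Proof.
case=> [a ad|Y Z a b _ [[_ b0 _ _] _]]; first by exists a.
(* The set [b] of a move is nonempty, so its index is not below 0. *)
by move: b0; rewrite -cardfs_gt0 /face_dim; lia.
Qed.

(** In dimension two, a vertex whose two neighbours are both not lower is a
    minimum, as the two edges span the cone of the polygon at this vertex. *)
Lemma polygon_descent (R : realFieldType) (I : finType) (U : (I -> R) -> Prop)
    (f : I -> R) (v a b y : I) :
  uniform_space U 3 -> U (fun=> 1) -> a != v -> b != v -> a != b ->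
  exposed U [set v; a] -> exposed U [set v; b] ->
  U f -> f y < f v -> (f a < f v) || (f b < f v).
Proof.
move=> [[_ UD] _ unq] U1 av bv ab [_ [p [Up p0 pp]]] [_ [q [Uq q0 qp]]] Uf fyv.
have pb : 0 < p b by apply: pp; rewrite !inE (negPf bv) eq_sym (negPf ab).
have qa : 0 < q a by apply: qp; rewrite !inE (negPf av) (negPf ab).
have pge i : 0 <= p i by case: (boolP (i \in [set v; a])) => [/p0 ->|/pp/ltW].
have qge i : 0 <= q i by case: (boolP (i \in [set v; b])) => [/q0 ->|/qp/ltW].
(* The function [f - f v - s p - t q] vanishes at [v], [a] and [b], hence everywhere; nonnegative
   [s] and [t] would give [f y >= f v]. *)
pose s := (f b - f v) / p b; pose t := (f a - f v) / q a.
have Uh := UD 1 (-1) _ _ (UD 1 (- f v) _ _ Uf U1) (UD s t _ _ Up Uq).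
have h0 : (1 * (1 * f y + - f v * 1) + -1 * (s * p y + t * q y)) = 0.
  apply: (unq [set v; a; b] _ _ Uh).
    by rewrite setUC cardsU1 cards2 !inE (negPf bv) [b == a]eq_sym (negPf ab)
      [v == a]eq_sym av.
  have pv : p v = 0 by rewrite p0 // !inE eqxx.
  have pa : p a = 0 by rewrite p0 // !inE eqxx orbT.
  have qv : q v = 0 by rewrite q0 // !inE eqxx.
  have qb : q b = 0 by rewrite q0 // !inE eqxx orbT.
  move=> i; rewrite !inE -orbA => /or3P[]/eqP->; rewrite /s /t ?pv ?pa ?qv ?qb.
  - by ring.
  - by field; rewrite !gt_eqF.
  - by field; rewrite !gt_eqF.
apply: contraT; rewrite negb_or -!leNgt => /andP[fa fb].
have s0 : 0 <= s by rewrite /s divr_ge0 ?subr_ge0 // ltW.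
have t0 : 0 <= t by rewrite /t divr_ge0 ?subr_ge0 // ltW.
have := mulr_ge0 s0 (pge y); have := mulr_ge0 t0 (qge y); lra.
Qed.

Theorem proposition3p9 (R : realType) (K : choiceType) (k : nat)
    (S : {fset {fset K}}) :
  is_complex S ->
  polytopal R S ->
  complex_dim S = (2 * k + 1)%N%:Z%R ->
  neighbourly k.+1 S ->
  W_class k (2 * k + 1)%N%:Z%R S.
Proof.
move=> [S0 Ssub] polyS dimS nbS.
have [Sle [a aS a_card]] := complex_dim_card dimS.
rewrite addn1 in Sle a_card.
have [|U [US U1 SU]] := polytopal_exposed polyS; first by exists a; rewrite ?a_card.
pose enc := fset_of_set (fun i : vertices S => val i).
have enc_sub (A B : {set vertices S}) : (enc A `<=` enc B)%fset = (A \subset B).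
  exact/fset_of_set_sub/val_inj.
have enc_card (A : {set vertices S}) : #|` enc A| = #|A|.
  exact/card_fset_of_set/val_inj.
have mem_enc (A : {set vertices S}) i : (val i \in enc A) = (i \in A).
  exact/mem_fset_of_set/val_inj.
have [top topE] := face_fset_of_set aS.
have exS (A B : {set vertices S}) : exposed U A -> B \subset A -> exposed U B.
  by move=> /SU AS BA; apply/SU; apply: Ssub AS _; rewrite enc_sub.
have nb (A : {set vertices S}) : #|A| = k.+1 -> exposed U A.
  move=> Ak; apply/SU/nbS; last by rewrite enc_card.
  by apply/fsubsetP => y /imfsetP[i _ ->]; exact: valP.
have small (A : {set vertices S}) : exposed U A -> (#|A| <= (2 * k).+2)%N.
  by move=> /SU/Sle; rewrite enc_card.
have top_ex : exposed U top by apply/SU; rewrite -topE.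
have top_card : #|top| = (2 * k).+2 by rewrite -enc_card /enc -topE.
have uni := neighbourly_uniform US U1 exS nb small top_ex top_card.
have V_card := card_top_ltn top_ex top_card.
have nb_le := exposed_small exS nb top_ex top_card.
pose c (i : vertices S) : nat := enum_rank i.
have c_inj : injective c by move=> i j /ord_inj/enum_rank_inj.
have linkS i := stellation_link i uni c_inj V_card nb_le.
have mem_link (i : vertices S) (A : {set vertices S}) :
    (enc A \in link S (val i)) = `[< i \notin A /\ exposed U (i |: A) >].
  have -> : (enc A \in link S (val i)) =
      [&& enc A \in S, val i \notin enc A & (val i |` enc A)%fset \in S].
    by rewrite !inE.
  rewrite mem_enc -fset_of_set1U; apply/and3P/asboolP.
    by case=> _ iA /SU.
  case=> iA ex; split=> //; last by apply/SU.
  by apply/SU; apply: exS ex _; exact: subsetUr.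
split=> //.
- suff conn (i j : vertices S) : exists p : seq (vertices S),
      path (fun u v => [fset val u; val v]%fset \in S) i p /\ last i p = j.
    move=> y z yV zV; have [p [pp pl]] := conn [` yV]%fset [` zV]%fset.
    by exists (map val p); rewrite -[y]/(val [` yV]%fset) path_map last_map pl.
  have edge (u v : vertices S) :
      exposed U [set u; v] -> [fset val u; val v]%fset \in S.
    move/SU; congr (_ \in S).
    apply/fsetP => t; rewrite !inE; apply/imfsetP/orP => [[l /=]|].
      by rewrite !inE => /orP[]/eqP-> ->; [left|right].
    by case=> /eqP ->; [exists u|exists v]; rewrite //= !inE eqxx ?orbT.
  (* For positive [k] any two vertices form an edge. For [k = 0] the sphere is a polygon, and edges
     are followed down a function whose minimum is at [j] only. *)
  have [k0|k0] := posnP k; last first.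
    exists [:: j]; split=> //=; rewrite andbT.
    by apply: (edge i j); apply: nb_le; rewrite cards2; case: (_ != _).
  have uni3 : uniform_space U 3 by move: uni; rewrite k0.
  have [|_ [f [Uf fj fp]]] := nb_le [set j]; first by rewrite cards1.
  have {}fj : f j = 0 by apply: fj; rewrite inE.
  have {}fp l : l != j -> 0 < f l by move=> lj; apply: fp; rewrite inE.
  have [m] := ubnP #|[set l : vertices S | f l < f i]|.
  elim: m i => // m IH i lt; have [->|ij] := eqVneq i j; first by exists [::].
  (* The link of [i] is the boundary of a two-element set, which provides two distinct
     neighbours. *)
  have [+ _] := linkS i; rewrite k0 => /stellation_index0[b b2 bE].
  have nbr p : p \in b -> exists u, [/\ c u = p, u != i & exposed U [set i; u]].
    move=> pb; have : [fset p]%fset \in boundary_simplex b.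
      rewrite in_boundary_simplex fsub1set pb /=; apply/eqP => e.
      by move: b2; rewrite -e cardfs1.
    rewrite -bE => /(complex_ofP c_inj)[A [iA exA] pA].
    have : p \in [fset p]%fset by rewrite inE.
    rewrite pA => /imfsetP[u /= uA ->]; exists u; split=> //.
      by apply: contraNneq iA => <-.
    apply: exS exA _; apply/subsetP => l; rewrite !inE => /orP[->//|/eqP->].
    by rewrite uA orbT.
  have [p pb] : exists p, p \in b by apply/fset0Pn; rewrite -cardfs_gt0; lia.
  have [q] : exists q, q \in (b `\ p)%fset.
    by apply/fset0Pn; rewrite -cardfs_gt0; have := cardfsD1 p b; rewrite pb; lia.
  rewrite !inE => /andP[qp qb].
  have [u [cu ui exu]] := nbr p pb; have [v [cv vi exv]] := nbr q qb.
  have uv : u != v by apply: contraNneq qp => e; rewrite -cu -cv e.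
  have step l : exposed U [set i; l] -> f l < f i ->
      exists p0 : seq (vertices S),
        path (fun u0 v0 => [fset val u0; val v0]%fset \in S) i p0 /\ last i p0 = j.
    move=> exl fl; have [|p0 [pp pl]] := IH l; last first.
      by exists (l :: p0); rewrite /= edge.
    rewrite -ltnS; apply: leq_trans lt; rewrite ltnS; apply: proper_card.
    apply/properP; split; last by exists l; rewrite !inE ?ltxx.
    by apply/subsetP => t; rewrite !inE => /lt_trans; apply.
  have fij : f j < f i by rewrite fj fp.
  by case/orP: (polygon_descent uni3 U1 ui vi uv exu exv Uf fij) => fl;
     apply: step fl.
- move=> y yV; pose i := [` yV]%fset.
  have [st [A [iA exA A_card]]] := linkS i.
  have -> : (2 * k + 1)%N%:Z - 1 = (2 * k)%N%:Z by lia.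
  split.
    rewrite (@complex_dimE _ _ (2 * k).+1); first by lia.
      move=> b; rewrite !inE => /and3P[_ yb /Sle]; by rewrite cardfsU1 yb.
    by exists (enc A); rewrite ?enc_card // (mem_link i); apply/asboolP.
  exists (complex_of c (fun A => i \notin A /\ exposed U (i |: A))); split=> //.
  (* The default value 0 applies only outside [vertices S], hence to no vertex of the link. *)
  pose h z := oapp c 0%N (insub z : option (vertices S)).
  have hE l : h (val l) = c l by rewrite /h valK.
  have linkV b z : b \in link S y -> z \in b -> exists l : vertices S, z = val l.
    rewrite inE => /andP[bS _] zb.
    have zV : z \in vertices S by apply/in_vertices; exists b.
    by exists [` zV]%fset.
  have hcE (B : {set vertices S}) : [fset h z | z in enc B]%fset = fset_of_set c B.
    apply/fsetP => m; apply/imfsetP/imfsetP =>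
      [[z /= /imfsetP[l /= lB ->] ->]|[l /= lB ->]].
      by exists l => //; exact: (hE l).
    by exists (val l); rewrite ?hE //; apply/imfsetP; exists l.
  exists h; split.
    move=> z t /in_vertices[b bL zb] /in_vertices[b' b'L tb'].
    have [l ->] := linkV b z bL zb; have [l' ->] := linkV b' t b'L tb'.
    by rewrite !hE => /c_inj ->.
  apply/fsetP => m; apply/complex_ofP/imfsetP => // [[B BP ->]|[b /= bL ->]].
    by exists (enc B); rewrite ?hcE // (mem_link i); apply/asboolP.
  have [B BE] : exists B : {set vertices S}, b = enc B.
    by apply: face_fset_of_set; move: bL; rewrite inE => /andP[].
  exists B; last by rewrite BE hcE.
  by apply/asboolP; rewrite -(mem_link i) -BE.
Qed.
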